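(* Let $k$ be a positive integer and let $(G,x,y)$ be a $2$-connected rooted graph. Suppose that $\deg_G(v)\ge 2k$ for every $v\in V(G)\setminus\{x,y\}$. Then $G$ contains $k$ paths from $x$ to $y$ satisfying the length condition.
   Context: All graphs are finite and simple. For distinct vertices $x,y$ of a graph $G$, $(G,x,y)$ is a rooted graph. A rooted graph $(G,x,y)$ is $2$-connected if (R1) $G$ is a connected graph of order at least $3$ with at most two end blocks, and (R2) every end block of $G$ contains at least one of $x$ and $y$ as a non-cut vertex (equivalently, the graph obtained from $G$ by adding the edge $xy$ if it is absent is $2$-connected). A sequence of paths $H_1,\dots,H_k$ satisfies the length condition if $|E(H_1)|\ge 2$ and $|E(H_{i+1})|-|E(H_i)|=2$ for $1\le i\le k-1$. *)

(* Defs.v *)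
From mathcomp Require Import all_boot.

Set Implicit Arguments.
Unset Strict Implicit.
Unset Printing Implicit Defensive.

(* MathComp. A finite simple graph is a symmetric irreflexive [e : rel T] on a
   [T : finType]. Every subgraph below is induced, hence is represented by its
   vertex set; this loses nothing for blocks, since a maximal connected
   subgraph without a cut vertex of its own is induced. *)

Section RootedGraphs.

Variables (T : finType) (e : rel T).
Implicit Types (S B : {set T}) (u v w x y : T).

Definition degree v : nat := #|[set u | e v u]|.

Definition induced S : rel T := [rel u v | [&& u \in S, v \in S & e u v]].

Definition connected_set S : bool :=
  (S != set0) && [forall u in S, forall w in S, connect (induced S) u w].

(* [v] separates, in the graph induced on [S], two other vertices of the same
   component. *)
Definition cut_vertex S v : bool :=
  (v \in S) &&
  [exists u in S :\ v, exists w in S :\ v,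
     connect (induced S) u w && ~~ connect (induced (S :\ v)) u w].

Definition block B : bool :=
  maxset [pred S | connected_set S && ~~ [exists v, cut_vertex S v]] B.

(* At most one cut vertex of the whole graph: a connected graph without cut
   vertices is its own unique block, and is an end block. *)
Definition end_block B : bool :=
  block B && (#|[set v in B | cut_vertex [set: T] v]| <= 1).

Definition rooted_R1 : bool :=
  [&& connected_set [set: T], 3 <= #|T| & #|[set B | end_block B]| <= 2].

Definition rooted_R2 x y : bool :=
  [forall (B | end_block B), exists z in [set x; y],
     (z \in B) && ~~ cut_vertex [set: T] z].

Definition two_connected_rooted x y : bool :=
  [&& x != y, rooted_R1 & rooted_R2 x y].

(* [p] lists the vertices of the path after its origin [x], so that the path
   has [size p] edges. *)
Definition path_from_to x y (p : seq T) : bool :=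
  [&& path e x p, last x p == y & uniq (x :: p)].

(* Meant for a nonempty sequence of paths, each encoded as in
   [path_from_to]. *)
Definition length_condition (H : seq (seq T)) : Prop :=
  2 <= size (nth [::] H 0) /\
  forall i, i.+1 < size H ->
    size (nth [::] H i.+1) = size (nth [::] H i) + 2.

End RootedGraphs.

(* Main.v *)
Require Import Defs.
From mathcomp Require Import all_boot.
From mathcomp Require Import zify.
From Stdlib Require Import Classical_Prop.

(** Induct on the number of vertices.  A set A containing x whose attachment
    vertices q all carry n paths from x inside A, with the same lengths h, h+2,
    ..., h+2(n-1), may be contracted to x; if the contraction costs every
    remaining vertex at most 2(n-1) neighbours, the k-n+1 paths given by
    induction extend to k paths.

    A is built from a complete bipartite graph K_{s+1,s+1} in G-y with x on the
    side S, where s is maximal and T consists of all common neighbours of S.  By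
    maximality a vertex outside has at most s neighbours in S and s+1 in T, so
    that deleting S\{x} and contracting T costs at most 2s, while x reaches
    every vertex of T by paths of lengths 1, 3, ..., 2s+1.  The contracted graph
    fails to be 2-connected only if some set K is attached to S and one more
    vertex w.  If s >= 2, one then enters K from S\{x}, which x reaches with
    lengths 2, 4, ..., 2s.  If s <= 1, K is cut off by at most three vertices
    including x: 2-separations are handled directly by induction, and for
    3-separations (where k >= 3) two families of k-1 paths in series give
    2k-3 >= k lengths.

    If y has no neighbour outside S and T, the contracted graph is instead
    linked to a neighbour t0 of y.  That x is the end with the smaller s
    guarantees that t0 can be taken in T when s >= 2. *)

Set Implicit Arguments.
Unset Strict Implicit.
Unset Printing Implicit Defensive.

(** The [T] of the overview is [Q] in the code, where [T] is the vertex type. One path fewer in the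
    induction lowers the degree demand by two, and [n] heads make up for [n - 1] missing paths;
    hence the budget [2 * (n - 1)]. With [n = s + 1], deleting one side of the core and contracting
    the other costs at most [s] neighbours on each side. Degrees thus survive, and the real obstacle
    is 2-connectedness. A set spoiling it sees no vertex of the contracted attachments [Q], since
    [x] would then be a second attachment; it sees only [w] and the deleted side, through which it
    is entered instead. An exit [t0] has to leave [Q]. If [#|Q| = s + 1], only [s] heads remain,
    which is too few exactly when some outside vertex sees [s] vertices of [S] and all of [Q] but
    [t0]; that vertex then joins the core and restores the missing length. For [s <= 1], unless some
    pair [{x, v}] has three common neighbours other than [y], a star at [x] is contracted: 4-cycles
    through [x] are so scarce that no degree is lost and single heads suffice. *)

Section Basics.
Variable T : finType.
Implicit Types (e : rel T) (A B C K L V Q X : {set T}) (a b u v w x y z t : T).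

(** * Paths of given length, attachments of vertex sets, and the contraction step *)

Definition upath e A x y n :=
  exists p, [/\ path e x p, last x p = y, uniq (x :: p),
                {subset x :: p <= A} & size p = n].

Lemma upath_sub e A B x y n : A \subset B -> upath e A x y n -> upath e B x y n.
Proof.
move=> AB [p [ep lp up sp zp]]; exists p; split=> // w /sp; exact: (subsetP AB).
Qed.

Lemma upath_mem e A x y n : upath e A x y n -> (x \in A) && (y \in A).
Proof.
by move=> [p [_ <- _ sp _]]; rewrite !sp ?mem_last ?mem_head.
Qed.

Lemma upath0 e A x : x \in A -> upath e A x x 0.
Proof. by move=> xA; exists [::]; split=> // w; rewrite inE => /eqP->. Qed.

Lemma upath_edge_cat e A B x u v y n m :
  upath e A x u n -> e u v -> upath e B v y m -> [disjoint A & B] ->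
  upath e (A :|: B) x y (n + m.+1).
Proof.
move=> [p [ep lp up sp <-]] euv [q [eq lq uq sq <-]] dAB.
exists (p ++ v :: q); split.
- by rewrite cat_path ep lp /= euv.
- by rewrite last_cat /= lq.
- rewrite -cat_cons cat_uniq up uq andbT; apply/hasPn => w wq.
  by apply/negP => /sp /(disjointFr dAB); rewrite (sq _ wq).
- move=> w; rewrite -cat_cons mem_cat in_setU => /orP[/sp->//|/sq->].
  by rewrite orbT.
- by rewrite size_cat.
Qed.

Lemma upath1 e A x y : x \in A -> y \in A -> x != y -> e x y -> upath e A x y 1.
Proof.
move=> xA yA xy exy; exists [:: y]; split=> //=.
- by rewrite exy.
- by rewrite inE xy.
- by move=> w; rewrite !inE => /orP[] /eqP->.
Qed.

Lemma upath_cat e A B x z y n m :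
  upath e A x z n -> upath e B z y m ->
  (forall w, w \in A -> w \in B -> w = z) ->
  upath e (A :|: B) x y (n + m).
Proof.
move=> Axz [[|v q] [/= eq lq uq sq <-]] AB.
  by rewrite -lq addn0; apply: upath_sub Axz; apply: subsetUl.
case/andP: eq => ezv eq; case/andP: uq => zq uq.
have Bvy : upath e (B :\ z) v y (size q).
  exists q; split=> // w wq; rewrite !inE sq ?inE ?wq ?orbT ?andbT //.
    by apply: contraNneq zq => <-.
  by move: wq; rewrite inE => ->; rewrite orbT.
apply: upath_sub (upath_edge_cat Axz ezv Bvy _).
  by apply: setUS; apply: subD1set.
rewrite disjoint_subset; apply/subsetP => w wA; rewrite !inE negb_and negbK.
by case: (boolP (w \in B)) => wB; rewrite ?orbT // (AB w) ?eqxx.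
Qed.

Lemma upath_rev e A x y n : symmetric e -> upath e A x y n -> upath e A y x n.
Proof.
move=> se [p [ep lp up sp <-]]; exists (rev (belast x p)).
have E : y :: rev (belast x p) = rev (x :: p).
  by rewrite (lastI x p) rev_rcons lp.
split.
- rewrite -lp rev_path; apply: sub_path ep => a b; by rewrite se.
- case: p lp {ep up sp E} => [|v p] //= _.
  by rewrite rev_cons last_rcons.
- by rewrite E rev_uniq.
- by move=> w; rewrite E mem_rev => /sp.
- by rewrite size_rev size_belast.
Qed.

(** Only an upper bound on the attachments of [K]: [X] may meet [K] or contain vertices that are not
    attached. So [[set z]] also covers sets without any attachment, and [set0] means closed under
    adjacency in [V]. *)
Definition border e V K X :=
  forall u w, u \in K -> w \in V -> e u w -> (w \in K) || (w \in X).

Definition component e A u := [set w in A | connect (induced e A) u w].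

Lemma component_sub e A u : component e A u \subset A.
Proof. by apply/subsetP => w; rewrite inE => /andP[]. Qed.

Lemma component_refl e A u : u \in A -> u \in component e A u.
Proof. by move=> uA; rewrite inE uA connect0. Qed.

Lemma component_closed e A u : border e A (component e A u) set0.
Proof.
move=> a b; rewrite !inE => /andP[aA ca] bA eab; rewrite bA orbF /=.
by apply: (connect_trans ca); apply: connect1; rewrite /induced /= aA bA.
Qed.

Lemma component_min e A K u : symmetric e ->
  K \subset A -> u \in K -> border e A K set0 -> component e A u \subset K.
Proof.
move=> se KA uK bK; apply/subsetP => w; rewrite inE => /andP[_ /connectP[p ep ->]].
elim: p u uK ep => //= v p IHp u uK /andP[/and3P[_ vA euv] ep].
by apply: (IHp v) ep; move: (bK _ _ uK vA euv); rewrite in_set0 orbF.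
Qed.

Lemma upath_component_exists e A u w : u \in A -> w \in component e A u ->
  exists n, upath e A u w n.
Proof.
move=> uA; rewrite inE => /andP[_ /connectP[p ep ->]].
case/shortenP: ep => q eq uq _; exists (size q), q; split=> //.
- by apply: sub_path eq => a b /and3P[].
- elim: q u uA eq {uq} => [|v q IHq] u uA /=; first by move=> _ w'; rewrite inE => /eqP->.
  case/andP=> /and3P[_ vA _] eq w'; rewrite inE => /predU1P[->//|].
  exact: IHq.
Qed.

Lemma upath_closure e A u v : u \in A ->
  (forall L, u \in L -> L \subset A -> border e A L set0 -> v \in L) ->
  exists n, upath e A u v n.
Proof.
move=> uA H; apply: upath_component_exists => //.
apply: H; [exact: component_refl | exact: component_sub | exact: component_closed].
Qed.

(* Every vertex of [C] is joined to [y] inside [C]: no nonempty set avoiding [y]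
   is closed under adjacency. *)
Definition rconn e C y :=
  forall K, K \subset C -> y \notin K -> border e C K set0 -> K = set0.

Lemma component_rconn e A u : symmetric e -> u \in A -> rconn e (component e A u) u.
Proof.
move=> se uA K KC uK bK; apply/eqP; apply: contraNT uK => /set0Pn[v vK].
have := subsetP KC v vK.
rewrite inE => /andP[vA cuv].
have su : connect_sym (induced e A).
  apply: sym_connect_sym => a b; rewrite /induced /= se andbCA; congr (_ && _).
rewrite su in cuv.
have /(component_min se) : K \subset A by apply: subset_trans KC (component_sub _ _ _).
move/(_ v vK) => H.
have : border e A K set0.
  move=> a b aK bA eab; apply: (bK a b) => //.
  have := component_closed (subsetP KC _ aK) bA eab.
  by rewrite in_set0 orbF.
move/H/subsetP; apply; by rewrite inE uA.
Qed.

(** If [w] could not reach [y] off [K], a closed part of [C :\: K] around [w] together with [K]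
    would be closed in [C] and miss [y]. It supplies the tails that leave a bad set through its
    attachment [w]. *)
Lemma rconn_avoid e C K y w : symmetric e -> rconn e C y -> K \subset C ->
  y \in C -> y \notin K -> w \in C -> w \notin K ->
  border e C K [set w] -> exists n, upath e (C :\: K) w y n.
Proof.
move=> se rC KC yC yK wC wK bK.
apply: upath_closure; first by rewrite inE wC wK.
move=> L wL LC bL; apply: contraTT isT => yL.
have /setP/(_ w) : K :|: L = set0.
  apply: rC.
  - rewrite subUset KC; apply: subset_trans LC _; exact: subsetDl.
  - by rewrite inE negb_or yK.
  move=> a b; rewrite !inE orbF => /orP[aK|aL] bC eab.
    by case/orP: (bK _ _ aK bC eab) => [->//|]; rewrite inE => /eqP->; rewrite wL orbT.
  case: (boolP (b \in K)) => //= bnK.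
  by have := bL _ _ aL _ eab; rewrite !inE bnK bC orbF => /(_ isT).
by rewrite !inE wL orbT.
Qed.

Definition dg e A v := #|[set u in A | e v u]|.

Lemma dg_cover e V A B v :
  (forall u, u \in V -> e v u -> (u \in A) || (u \in B)) ->
  dg e V v <= dg e A v + dg e B v.
Proof.
move=> H; apply: leq_trans (leq_card_setU _ _).
apply: subset_leq_card; apply/subsetP => u; rewrite !inE => /andP[uV evu].
by rewrite evu !andbT H.
Qed.

Lemma dg_sub e A B v : A \subset B -> dg e A v <= dg e B v.
Proof.
move=> AB; apply: subset_leq_card; apply/subsetP => u; rewrite !inE.
by case/andP=> /(subsetP AB)-> ->.
Qed.

Lemma dg_card e A v : dg e A v <= #|A|.
Proof. by apply: subset_leq_card; apply/subsetP => u; rewrite inE => /andP[]. Qed.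

Lemma dg_set1 e v z : dg e [set z] v <= 1.
Proof. by apply: leq_trans (dg_card _ _ _) _; rewrite cards1. Qed.

Lemma dg_gt0P e A v : reflect (exists2 q, q \in A & e v q) (0 < dg e A v).
Proof.
rewrite card_gt0; apply: (iffP (set0Pn _)) => -[q].
  by rewrite inE => /andP[]; exists q.
by move=> qA evq; exists q; rewrite inE qA.
Qed.

Definition paths2 e V x y k :=
  exists a0 : nat, 2 <= a0 /\ forall i, i < k -> upath e V x y (a0 + 2 * i).

(* 2-connectedness of the rooted graph: a nonempty set avoiding [x] and [y] has at
   least two neighbours outside. *)
Definition rooted e V x y :=
  [/\ x \in V, y \in V, x != y, V :\: [set x; y] != set0 &
      forall K z, K \subset V :\: [set x; y] -> K != set0 ->
        ~ border e V K [set z]].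

(** The escape [k <= 1] holds because a single path of length at least 2 needs no degree condition.
    It allows a contraction to ask for one path even when the degree budget is exhausted. *)
Definition min_deg e V x y k :=
  forall v, v \in V -> v != x -> v != y -> k <= 1 \/ 2 * k <= dg e V v.

(** The relation is quantified and the vertex set is a subset of one fixed type, so a contracted
    graph is obtained by redefining adjacency at [x], without changing the type. *)
Definition theorem_below m := forall e V x y k, symmetric e -> irreflexive e ->
  #|V| < m -> rooted e V x y -> min_deg e V x y k -> paths2 e V x y k.

(* The induction hypothesis is applied to [C] together with [x], where [x] inherits
   the neighbours of [Q] and of no other vertex of [A].  Its [k'] paths, preceded by
   the [n] paths inside [A], have [n + k' - 1] different lengths. *)
Lemma contract e V x y k C A Q B h n k' y' m :
  symmetric e -> irreflexive e -> theorem_below #|V| ->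
  A \subset V -> C \subset V -> B \subset V -> [disjoint A & C] ->
  x \in A -> Q \subset A -> y' \in C -> #|C|.+1 < #|V| -> C :\ y' != set0 ->
  (forall q i, q \in Q -> i < n -> upath e A x q (h + 2 * i)) ->
  upath e B y' y m ->
  (forall w, w \in B -> w \in A :|: C -> w = y') ->
  rconn e C y' ->
  (forall K z, K \subset C -> y' \notin K -> K != set0 -> z \in C ->
     ~ border e (C :|: Q) K [set z]) ->
  (forall v, v \in C -> v != y' ->
     k' <= 1 \/ 2 * k' <= dg e C v + (0 < dg e Q v)) ->
  0 < n -> 0 < k' -> k < n + k' ->
  paths2 e V x y k.
Proof.
move=> se ie IH AV CV BV dAC xA QA y'C cC C0 heads tail hB h1 h2 hdeg n0 k'0 knk.
have xC : x \notin C by rewrite (disjointFr dAC xA).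
have neqx v : v \in C -> (v == x) = false.
  by move=> vC; apply: contraNF xC => /eqP<-.
have [cr [crC crx scr icr]] : exists cr : rel T,
    [/\ forall u v, u \in C -> v \in C -> cr u v = e u v,
        forall v, v \in C -> cr x v = (0 < dg e Q v),
        symmetric cr & irreflexive cr].
  (* The original edges at [x] are dropped: in the contracted graph [x] sees exactly the vertices of
     [C] with a neighbour in [Q]. *)
  exists [rel u v | [|| [&& u == x, v \in C & 0 < dg e Q v],
                        [&& v == x, u \in C & 0 < dg e Q u] |
                        [&& u \in C, v \in C & e u v]]].
  split=> [u v uC vC|v vC|u v|u] /=.
  - by rewrite !neqx // uC vC.
  - by rewrite eqxx vC neqx //= (negbTE xC) orbF.
  - by rewrite (se u v) orbCA (andbCA (u \in C)).
  - rewrite ie !andbF orbF orbb; case: eqP => //= ->.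
    by rewrite (negbTE xC).
have [] : paths2 cr (x |: C) x y' k'.
  apply: IH => //.
  - by rewrite cardsU1 xC.
  - split; rewrite ?in_setU1 ?eqxx ?y'C ?orbT //.
    + by rewrite eq_sym neqx.
    + case/set0Pn: C0 => v; rewrite !inE => /andP[vy vC]; apply/set0Pn; exists v.
      by rewrite !inE vC orbT negb_or vy neqx.
    move=> K z KV K0 bK.
    have KC : K \subset C.
      apply/subsetP => v /(subsetP KV); rewrite !inE negb_or.
      by case: (v == x) => //= /andP[].
    have yK : y' \notin K.
      by apply/negP => /(subsetP KV); rewrite !inE eqxx orbT.
    (* If the only attachment [z] is in [C], then [K] has no neighbour in [Q], as [x] would be a
       second attachment, and [h2] applies. Otherwise [K] is closed in [C], and [h1] makes it
       empty. *)
    case: (boolP (z \in C)) => zC.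
      apply: (h2 K z) => // u w uK; rewrite in_setU => /orP[wC|wQ] euw.
        have euw' : cr u w by rewrite crC // (subsetP KC).
        by apply: (bK u w uK _ euw'); rewrite in_setU1 wC orbT.
      have uC := subsetP KC _ uK.
      have /(bK u x uK) : x \in x |: C by rewrite !inE eqxx.
      rewrite scr crx //.
      have -> : 0 < dg e Q u by apply/dg_gt0P; exists w.
      move=> /(_ isT) /orP[/(subsetP KC)|]; first by rewrite (negbTE xC).
      by rewrite inE => /eqP xz; rewrite -xz (negbTE xC) in zC.
    case/negP: K0; apply/eqP; apply: h1 => // u w uK wC euw.
    rewrite in_set0 orbF.
    have /(bK u w uK) : w \in x |: C by rewrite !inE wC orbT.
    rewrite crC // ?(subsetP KC _ uK) // => /(_ euw) /orP[//|].
    by rewrite inE => /eqP wz; rewrite -wz wC in zC.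
  - move=> v; rewrite in_setU1 => /predU1P[->|vC]; first by rewrite eqxx.
    move=> _ vy; case: (hdeg v vC vy) => [|H]; [by left|right].
    apply: leq_trans H _; rewrite /dg.
    rewrite (cardsD1 x [set u in x |: C | cr v u]) addnC.
    apply: leq_add.
      by rewrite !inE eqxx scr crx.
    apply: subset_leq_card; apply/subsetP => u; rewrite inE => /andP[uC evu].
    by rewrite in_setD1 neqx // inE in_setU1 uC crC // evu orbT.
move=> a [a2 Ha].
exists (h + a + m); split; first by lia.
move=> l lk.
(* The index [l] is split as [i + j], using up the heads first; [k < n + k'] leaves [j < k']. The
   first edge of the contracted path opens into a real edge from some [q] in [Q], already counted in
   [a]. *)
pose i := minn l n.-1.
have [j [jk lij]] : exists j, j < k' /\ l = i + j.
  by exists (l - i); rewrite /i; lia.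
have inn : i < n by rewrite /i; lia.
have [p [ep lp up sp zp]] := Ha j jk.
case: p ep lp up sp zp => [|v p] //=; first by lia.
case/andP=> exv ep lp /andP[xp up] sp zp.
have pC : {subset v :: p <= C}.
  move=> w wp; have : w \in x |: C by apply: sp; rewrite inE wp orbT.
  rewrite in_setU1 => /predU1P[wx|//]; by rewrite -wx wp in xp.
have vC : v \in C by apply: pC; rewrite mem_head.
rewrite crx // in exv.
case/dg_gt0P: exv => q qQ evq.
have Cv : upath e C v y' (size p).
  exists p; split=> //.
  elim: p v ep pC vC {xp up sp zp evq lp} => //= b p IHp v /andP[cvb ep] pC vC.
  have bC : b \in C by apply: pC; rewrite !inE eqxx orbT.
  rewrite crC // in cvb.
  rewrite cvb; apply: IHp => // w wp; apply: pC; by rewrite inE wp orbT.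
rewrite se in evq.
have E := upath_edge_cat (heads q i qQ inn) evq Cv dAC.
have := upath_cat E tail _.
have -> : h + 2 * i + (size p).+1 + m = h + a + m + 2 * l.
  by clearbody i; move: lij zp; clear; lia.
move=> H; apply: upath_sub (H _); first by rewrite !subUset AV CV BV.
by move=> w wAC wB; apply: hB.
Qed.

End Basics.

(** * Paths through a given vertex and 2-separations *)

Section Through.
Variable T : finType.
Implicit Types (e : rel T) (A B C K L V Q X : {set T}) (a b u v w x y z t : T).

Lemma borderPn e V K X : ~ border e V K X ->
  exists u w, [/\ u \in K, w \in V, e u w, w \notin K & w \notin X].
Proof.
move=> nb.
case: (boolP [exists u in K, [exists w in V, [&& e u w, w \notin K & w \notin X]]]).
  case/existsP => u /andP[uK /existsP[w /andP[wV /and3P[? ? ?]]]].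
  by exists u, w.
move=> /existsPn H; case: nb => u w uK wV euw.
have := H u; rewrite uK /= => /existsPn/(_ w); rewrite wV euw /=.
by rewrite negb_and !negbK.
Qed.

Definition passes e V x y w := exists p,
  [/\ path e x p, last x p = y, uniq (x :: p), {subset x :: p <= V} & w \in x :: p].

Lemma upath_passes e V A B x w y n m : A \subset V -> B \subset V ->
  upath e A x w n -> upath e B w y m ->
  (forall v, v \in A -> v \in B -> v = w) -> passes e V x y w.
Proof.
move=> AV BV [p [ep lp up sp _]] [q [eq lq uwq sq _]] AB.
have /andP[wq uq] : (w \notin q) && uniq q := uwq.
exists (p ++ q); split.
- by rewrite cat_path ep lp eq.
- by rewrite last_cat lp.
- rewrite -cat_cons cat_uniq up uq andbT; apply/hasPn => v vq.
  apply/negP => /sp vA; have vB : v \in B by apply: sq; rewrite inE vq orbT.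
  by case/negP: wq; rewrite -(AB v vA vB).
- move=> v; rewrite -cat_cons mem_cat => /orP[/sp|vq]; first exact: (subsetP AV).
  by apply: (subsetP BV); apply: sq; rewrite inE vq orbT.
- by rewrite -cat_cons mem_cat -lp mem_last.
Qed.

Lemma upath_prefix e x p a : path e x p -> uniq (x :: p) -> a \in x :: p ->
  upath e [set v in take (index a (x :: p)).+1 (x :: p)] x a (index a (x :: p)).
Proof.
move=> ep up ap; set i := index a (x :: p).
have ip : i <= size p by rewrite -ltnS -[(size p).+1]/(size (x :: p)) index_mem.
have E : take i.+1 (x :: p) = x :: take i p by [].
exists (take i p); split.
- exact: take_path.
- by rewrite (last_nth x) size_takel // -E nth_take // nth_index.
- by rewrite -E take_uniq.
- by move=> v vp; rewrite inE E.
- by rewrite size_takel.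
Qed.

Lemma upath_suffix e x p a : path e x p -> uniq (x :: p) -> a \in x :: p ->
  exists n, upath e [set v in drop (index a (x :: p)) (x :: p)] a (last x p) n.
Proof.
move=> ep up ap; set i := index a (x :: p).
have ip : i < size (x :: p) by rewrite index_mem.
have E : drop i (x :: p) = a :: drop i p.
  by rewrite (drop_nth x) // nth_index.
exists (size (drop i p)), (drop i p); split=> //.
- have := drop_sorted i (_ : sorted e (x :: p)).
  by rewrite E => /(_ ep).
- transitivity (last x (x :: p)) => //.
  by rewrite -[in RHS](cat_take_drop i (x :: p)) last_cat E.
- by rewrite -E drop_uniq.
- by move=> v vp; rewrite inE E.
Qed.

Lemma index_cut (s : seq T) a b : uniq s -> index a s < index b s ->
  [disjoint [set v in take (index a s).+1 s] & [set v in drop (index b s) s]].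
Proof.
move=> us ab; rewrite disjoint_subset; apply/subsetP => v; rewrite !inE.
set i := index a s in ab *; set j := index b s in ab *.
move=> vt; apply/negP => vd.
have : uniq (take i.+1 s ++ drop i.+1 s) by rewrite cat_take_drop.
rewrite cat_uniq => /and3P[_ /hasPn/(_ v) + _].
rewrite vt => /(_ _)/negP; apply=> //.
by move: vd; rewrite -[j](subnK ab) -drop_drop => /mem_drop.
Qed.

Lemma upath_in_component e A u w : symmetric e -> u \in A -> w \in component e A u ->
  exists n, upath e (component e A u) u w n.
Proof.
move=> se uA wC; apply: upath_closure; first exact: component_refl.
move=> L uL LC bL; apply: subsetP wC; apply: component_min => //.
  by apply: subset_trans LC (component_sub _ _ _).
move=> a b aL bA eab; apply: (bL a b aL _ eab).
by have := component_closed (subsetP LC _ aL) bA eab; rewrite in_set0 orbF.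
Qed.

(** If [u] is off the path, its component [K] off the path has, by rootedness, an attachment [b]
    other than [w], necessarily on the path. The segment between [w] and [b] is replaced by a detour
    through [u] and [K], in the direction dictated by the order of [w] and [b]. *)
Lemma passes_step e V x y w u : symmetric e -> rooted e V x y ->
  passes e V x y w -> e w u -> u \in V -> passes e V x y u.
Proof.
move=> se [xV yV xy V0 R] [p [ep lp up sp wp]] ewu uV.
case: (boolP (u \in x :: p)) => unp; first by exists p.
pose P := [set v in x :: p]; pose K := component e (V :\: P) u.
have KV : K \subset V :\: P by exact: component_sub.
have uK : u \in K by apply: component_refl; rewrite !inE uV -in_cons unp.
have xP : x \in P by rewrite inE mem_head.
have yP : y \in P by rewrite inE -lp mem_last.
have /borderPn[k [b [kK bV ekb bK]]] : ~ border e V K [set w].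
  apply: R; last by apply/set0Pn; exists u.
  apply/subsetP => v /(subsetP KV); rewrite !inE => /andP[vp ->].
  rewrite andbT; apply: contra vp => /orP[]/eqP->; first by rewrite eqxx.
  by rewrite -in_cons -lp mem_last.
rewrite inE => bw.
have bP : b \in P.
  apply: contraNT bK => bP.
  have := component_closed kK _ ekb; rewrite in_set0 orbF; apply.
  by rewrite inE bP.
have [nk uk] : exists n, upath e K u k n.
  by apply: upath_in_component => //; rewrite !inE -in_cons unp.
have dK (S : {set T}) : S \subset P -> [disjoint S & K].
  move=> SP; rewrite disjoint_sym disjoint_subset; apply/subsetP => v /(subsetP KV).
  by rewrite in_setD => /andP[+ _]; apply: contra => /(subsetP SP).
have du (S : {set T}) : S \subset P -> [disjoint S & [set u]].
  move=> SP; rewrite disjoint_sym disjoints1; apply: contra unp => /(subsetP SP).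
  by rewrite inE.
have uu : upath e [set u] u u 0 by apply: upath0; rewrite inE.
have PV : P \subset V by apply/subsetP => v; rewrite inE => /sp.
have KV' : K \subset V by apply: subset_trans KV (subsetDl _ _).
have uV' : [set u] \subset V by rewrite sub1set.
have tP i : [set v in take i (x :: p)] \subset P.
  by apply/subsetP => v; rewrite !inE -in_cons => /mem_take.
have dP i : [set v in drop i (x :: p)] \subset P.
  by apply/subsetP => v; rewrite !inE -in_cons => /mem_drop.
have inter (S1 S2 S3 : {set T}) v : [disjoint S1 & S2] -> v \in S1 -> v \in S2 -> v \in S3.
  by move=> d v1; rewrite (disjointFr d v1).
rewrite inE in bP.
case: (ltngtP (index w (x :: p)) (index b (x :: p))) => [wb|bw'|wb].
- have A1 := upath_prefix ep up wp.
  have [m A2] := upath_suffix ep up bP; rewrite lp in A2.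
  have B1 := upath_edge_cat A1 ewu uu (du _ (tP _)).
  have := dK _ (dP (index b (x :: p))); rewrite disjoint_sym => d2.
  have B2 := upath_edge_cat uk ekb A2 d2.
  apply: upath_passes B1 B2 _.
  + by rewrite subUset (subset_trans (tP _) PV).
  + by rewrite subUset KV' (subset_trans (dP _) PV).
  move=> v; rewrite !in_setU in_set1 => /orP[v1|/eqP->//] /orP[]v2.
    exact/set1P/(inter _ _ _ _ (dK _ (tP _)) v1 v2).
  exact/set1P/(inter _ _ _ _ (index_cut up wb) v1 v2).
- have A1 := upath_prefix ep up bP.
  have [m A2] := upath_suffix ep up wp; rewrite lp in A2.
  have ku := upath_rev se uk.
  have ebk : e b k by rewrite se.
  have euw : e u w by rewrite se.
  have B1 := upath_edge_cat A1 ebk ku (dK _ (tP _)).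
  have := du _ (dP (index w (x :: p))); rewrite disjoint_sym => d2.
  have B2 := upath_edge_cat uu euw A2 d2.
  apply: upath_passes B1 B2 _.
  + by rewrite subUset KV' (subset_trans (tP _) PV).
  + by rewrite subUset uV' (subset_trans (dP _) PV).
  move=> v; rewrite !in_setU in_set1 => /orP[v1|v1] /orP[/eqP//|v2].
    exact/set1P/(inter _ _ _ _ (index_cut up bw') v1 v2).
  exact/set1P/(inter _ _ _ _ (dK _ (dP _)) v2 v1).
- by case/eqP: bw; rewrite -(nth_index x bP) -wb nth_index.
Qed.

Lemma passes_all e V x y w : symmetric e -> rooted e V x y ->
  w \in V -> passes e V x y w.
Proof.
move=> se R wV; have [xV yV xy V0 HR] := R.
have reach v : v \in V -> exists n, upath e V x v n.
  move=> vV; apply: upath_closure => // L xL LV bL; apply: contraT => vL.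
  (* [L] is closed, contains [x] and misses [v]. Vertices outside [L] other than [y] would be
     attached to [y] alone; if there are none, then [v = y] and [L :\ x] is attached to [x]
     alone. *)
  case: (boolP (V :\: (L :|: [set y]) == set0)) => [/eqP E|N0].
    have vy : v = y.
      apply: contraNeq vL => vy; move/setP/(_ v): E; rewrite !inE vV (negbTE vy) orbF andbT.
      by move/negbFE.
    rewrite vy in vL.
    case: (boolP (L :\ x == set0)) => [/eqP Lx|N0]; last first.
      case: (HR (L :\ x) x) => //.
        apply/subsetP => u; rewrite !inE => /andP[ux uL].
        rewrite (subsetP LV _ uL) andbT negb_or ux /=.
        by apply: contraNneq vL => <-.
      move=> a b; rewrite !inE => /andP[ax aL] bV eab.
      have := bL _ _ aL bV eab; rewrite in_set0 orbF => ->.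
      by rewrite andbT orNb.
    case/set0Pn: V0 => u; rewrite !inE negb_or => /andP[/andP[ux uy] uV].
    move/setP/(_ u): E; rewrite !inE uV (negbTE uy) orbF andbT => /negbFE uL.
    by move/setP/(_ u): Lx; rewrite !inE ux uL.
  case: (HR _ y _ N0).
    apply/subsetP => u; rewrite !inE negb_or => /andP[/andP[uL uy] uV].
    rewrite uV andbT negb_or uy andbT.
    by apply: contraNneq uL => ->.
  move=> a b; rewrite !inE !negb_or => /andP[/andP[aL _] aV] bV eab.
  rewrite bV andbT; case: (b == y); rewrite ?orbT // andbT orbF.
  apply: contra aL => bL'; rewrite se in eab.
  by have := bL _ _ bL' aV eab; rewrite in_set0 orbF.
have [n xy_link] := reach y yV.
have px : passes e V x y x.
  have [p [ep lp up sp _]] := xy_link.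
  by exists p; split; rewrite ?mem_head.
have [m [p [ep <- _ sp _]]] := reach w wV.
have H : forall q z, passes e V x y z -> path e z q -> {subset q <= V} ->
    passes e V x y (last z q).
  elim=> //= v q IHq z pz /andP[ezv eq] sq; apply: IHq => // [|u uq].
    by apply: passes_step pz ezv _; rewrite ?sq ?mem_head.
  by apply: sq; rewrite inE uq orbT.
by apply: H => // u up; apply: sp; rewrite inE up orbT.
Qed.

Lemma paths2_sub e e' V x y k : subrel e e' -> paths2 e V x y k -> paths2 e' V x y k.
Proof.
move=> ee [a [a2 H]]; exists a; split=> // i /H [p [ep lp up sp zp]].
by exists p; split=> //; apply: sub_path ep.
Qed.

Lemma paths2_sym e V x y k : symmetric e -> paths2 e V x y k -> paths2 e V y x k.
Proof. by move=> se [a [a2 H]]; exists a; split=> // i /H/(upath_rev se). Qed.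

Lemma paths2_le1 e V x y k : symmetric e -> rooted e V x y -> k <= 1 -> paths2 e V x y k.
Proof.
move=> se R k1; have [_ _ xy /set0Pn[w]] := R.
rewrite !inE negb_or => /andP[/andP[wx wy] wV] _.
have [p [ep lp up sp wp]] := passes_all se R wV.
exists (size p); split.
  case: p ep lp up sp wp => [|v [|v' p]] //= _ lp _ _; rewrite !inE.
    by rewrite (negbTE wx).
  by rewrite lp (negbTE wx) (negbTE wy).
by move=> [|i] ik; [rewrite addn0; exists p | have := leq_trans ik k1].
Qed.

Lemma upath_behead e A x y n : upath e A x y n.+1 ->
  exists2 v, e x v & upath e (A :\ x) v y n.
Proof.
move=> [[|v p] [//= /andP[exv ep] lp /andP[xp up] sp [zp]]]; exists v => //.
exists p; split=> // w wp; rewrite in_setD1 sp ?inE ?wp ?orbT ?andbT //.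
  by apply: contraNneq xp => <-.
by move: wp; rewrite inE => ->; rewrite orbT.
Qed.

(** The path is stopped just before its first vertex in [K]. *)
Lemma upath_entry e A K z c n : symmetric e -> z \notin K -> c \in K ->
  upath e A z c n ->
  exists a u j, [/\ a \notin K, a \in A, u \in K, e u a & upath e (A :\: K) z a j].
Proof.
move=> se + cK; elim: n A z => [|n IHn] A z zK pl.
  by case: pl zK => [[|v q] [//= _ ->]]; rewrite cK.
have [zA _] := andP (upath_mem pl).
have [v ezv vl] := upath_behead pl.
case: (boolP (v \in K)) => vK.
  exists z, v, 0; split=> //; first by rewrite se.
  by apply: upath0; rewrite inE zK.
have [a [u [j [aK aA uK eua lj]]]] := IHn _ _ vK vl.
exists a, u, (0 + j.+1); split=> //.
  by move: aA; rewrite in_setD1 => /andP[].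
have zz : upath e [set z] z z 0 by apply: upath0; rewrite inE.
apply: upath_sub (upath_edge_cat zz ezv lj _).
  rewrite subUset sub1set inE zK zA; apply: setSD; exact: subD1set.
by rewrite disjoints1 !inE eqxx andbF.
Qed.

(* A path through a vertex of [K] provides disjoint paths linking [x] and [y] to the
   two attachment vertices of [K]. *)
Lemma two_sep e V x y k K z1 z2 :
  symmetric e -> irreflexive e -> theorem_below T #|V| -> rooted e V x y ->
  min_deg e V x y k -> 0 < k ->
  K \subset V -> x \notin K -> y \notin K -> K != set0 ->
  (exists t, [/\ t \in V, t \notin K, t != z1 & t != z2]) ->
  border e V K [set z1; z2] -> paths2 e V x y k.
Proof.
move=> se ie IH R hdeg k0 KV xK yK K0 [t [tV tK tz1 tz2]] bK.
have [xV yV xy V0 HR] := R.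
case/set0Pn: (K0) => c cK.
have [p [ep lp up sp cp]] := passes_all se R (subsetP KV _ cK).
pose i := index c (x :: p).
have := upath_prefix ep up cp; set P1 := [set v in _] => A1.
have := upath_suffix ep up cp; set P2 := [set v in _]; rewrite lp => -[m A2].
have P1V : P1 \subset V by apply/subsetP => v; rewrite inE => /mem_take/sp.
have P2V : P2 \subset V by apply/subsetP => v; rewrite inE => /mem_drop/sp.
have P12 v : v \in P1 -> v \in P2 -> v = c.
  move=> v1 v2; apply/eqP; apply: contraT => vc.
  have vd : v \in drop i.+1 (x :: p).
    move: v2; rewrite inE (drop_nth x) ?index_mem // nth_index // inE.
    by rewrite (negbTE vc).
  have : uniq (take i.+1 (x :: p) ++ drop i.+1 (x :: p)) by rewrite cat_take_drop.
  rewrite cat_uniq => /and3P[_ /hasPn/(_ v vd) + _].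
  by move: v1; rewrite inE => ->.
have [a [u [j [aK aP1 uK eua la]]]] := upath_entry se xK cK A1.
have [b [u' [j' [bnK bP2 uK' eub lb]]]] := upath_entry se yK cK (upath_rev se A2).
(* The two halves of the path meet only in [c], which lies in [K]; so the entries differ, and they
   are the two attachments [z1] and [z2]. *)
have ab : a != b.
  by apply: contraNneq aK => ab; rewrite (P12 a) // ab.
have aV := subsetP P1V _ aP1; have bV := subsetP P2V _ bP2.
have bKab : border e V K [set a; b].
  have := bK _ _ uK aV eua; have := bK _ _ uK' bV eub.
  rewrite (negbTE aK) (negbTE bnK) !inE /= => hb ha v w vK wV evw.
  have := bK _ _ vK wV evw; rewrite !inE; case: (w \in K) => //=.
  by case/orP: ha ab => /eqP->; case/orP: hb => /eqP->; rewrite ?eqxx // orbC.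
have tab : t \notin [set a; b].
  have := bK _ _ uK aV eua; have := bK _ _ uK' bV eub.
  rewrite (negbTE aK) (negbTE bnK) !inE /= => hb ha.
  by rewrite negb_or; case/orP: ha => /eqP->; case/orP: hb => /eqP->; rewrite ?tz1 ?tz2.
have aA : a \in P1 :\: K by rewrite inE aK.
have dAC : [disjoint P1 :\: K & K :|: [set b]].
  rewrite disjoint_subset; apply/subsetP => v; rewrite in_setD => /andP[vK v1].
  rewrite !inE (negbTE vK) /=; apply: contraNneq vK => vb.
  by rewrite (P12 v) // vb.
have KbV : K :|: [set b] \subset V by rewrite subUset KV sub1set.
(* One head and [k' = k]: no degree is lost, since [a] turns into [x] and [b] is the new root. The
   vertex [t] makes the new graph strictly smaller. *)
apply: (@contract _ e V x y k (K :|: [set b]) (P1 :\: K) [set a] (P2 :\: K)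
   j 1 k b j' se ie IH) => //.
- exact: subset_trans (subsetDl _ _) P1V.
- exact: subset_trans (subsetDl _ _) P2V.
- by have /andP[] := upath_mem la.
- by rewrite sub1set.
- by rewrite !inE eqxx orbT.
- have : t |: (a |: (K :|: [set b])) \subset V.
    by rewrite !subUset !sub1set tV aV KV bV.
  move/subset_leq_card; apply: leq_trans.
  rewrite !cardsU1 !inE (negbTE tK) (negbTE aK) (negbTE ab) /=.
  by move: tab; rewrite !inE => /negbTE->.
- by apply/set0Pn; exists c; rewrite !inE cK andbT; apply: contraNneq bnK => <-.
- by move=> q [|i'] // /set1P-> _; rewrite muln0 addn0.
- exact: upath_rev lb.
- move=> w wB; rewrite in_setU => /orP[wA|].
    move: wA wB; rewrite !in_setD => /andP[wK w1] /andP[_ w2].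
    by rewrite (P12 w) ?cK in wK.
  by move: wB; rewrite in_setD => /andP[/negbTE wK _]; rewrite in_setU wK => /set1P.
- move=> L LC bL brL; apply/eqP; apply: contraT => L0.
  have LK : L \subset K.
    apply/subsetP => v vL; have := subsetP LC _ vL; rewrite !inE.
    by case/orP=> // /eqP vb; rewrite vb (negbTE bL) in vL.
  case: (HR L a) => //.
    apply/subsetP => v vL; have vK := subsetP LK _ vL.
    rewrite !inE negb_or (subsetP KV) // andbT.
    by apply/andP; split; [apply: contraNneq xK | apply: contraNneq yK] => <-.
  move=> v w vL wV evw.
  have := bKab _ _ (subsetP LK _ vL) wV evw; rewrite !inE => H.
  case: (w == a) H; rewrite ?orbT //= => H.
  by have := brL _ _ vL _ evw; rewrite !inE; apply.
- move=> L z LC bL L0 zC brL.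
  have LK : L \subset K.
    apply/subsetP => v vL; have := subsetP LC _ vL; rewrite !inE.
    by case/orP=> // /eqP vb; rewrite vb (negbTE bL) in vL.
  case: (HR L z) => //.
    apply/subsetP => v vL; have vK := subsetP LK _ vL.
    rewrite !inE negb_or (subsetP KV) // andbT.
    by apply/andP; split; [apply: contraNneq xK | apply: contraNneq yK] => <-.
  move=> v w vL wV evw; apply: (brL v w) => //.
  have := bKab _ _ (subsetP LK _ vL) wV evw; rewrite !inE.
  by case: (w \in K) => //=; rewrite orbC.
- move=> v vC vb; have vK : v \in K.
    by move: vC; rewrite !inE (negbTE vb) orbF.
  case: (hdeg v (subsetP KV _ vK)) => [||?|H]; [| |by left|right].
  + by apply: contraNneq xK => <-.
  + by apply: contraNneq yK => <-.
  apply: leq_trans H _; apply: leq_trans (dg_cover (A := K :|: [set b]) (B := [set a]) _) _.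
    move=> w wV evw; have := bKab _ _ vK wV evw; rewrite !inE.
    by case: (w \in K) => //=; rewrite orbC.
  by rewrite leq_add2l; have := dg_set1 e v a; case: (dg _ _ _) => [|[]].
Qed.
End Through.

(** * Paths in complete bipartite graphs *)

Section Heads.
Variable T : finType.
Implicit Types (e : rel T) (A B C K L V Q X S : {set T}) (a b u v w x y z t : T).

Lemma upath_cons e A z v y n : z \notin A -> e z v -> upath e A v y n ->
  upath e (z |: A) z y n.+1.
Proof.
move=> zA ezv pl.
have zz : upath e [set z] z z 0 by apply: upath0; rewrite inE.
by apply: (upath_edge_cat zz ezv pl); rewrite disjoints1.
Qed.

Lemma card_gt1_D1 Q t : t \in Q -> 1 < #|Q| -> exists2 u, u \in Q & u != t.
Proof.
move=> tQ; rewrite (cardsD1 t) tQ ltnS card_gt0 => /set0Pn[u].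
by rewrite in_setD1 => /andP[ut uQ]; exists u.
Qed.

Lemma card_D1 Q t n : t \in Q -> #|Q| = n.+1 -> #|Q :\ t| = n.
Proof. by move=> tQ; rewrite (cardsD1 t) tQ => -[]. Qed.

Lemma ltn_card_D1 Q t n : t \in Q -> n.+1 < #|Q| -> n < #|Q :\ t|.
Proof. by move=> tQ; rewrite (cardsD1 t) tQ ltnS. Qed.

Lemma dg_gt1P e Q v : 1 < dg e Q v ->
  exists b c, [/\ b \in Q, c \in Q, c != b, e v b & e v c].
Proof.
move=> H; have /set0Pn[b bQ] : [set u in Q | e v u] != set0.
  by rewrite -card_gt0; apply: leq_trans H.
have [c + cb] := card_gt1_D1 bQ H.
by move: bQ; rewrite !inE => /andP[? ?] /andP[? ?]; exists b, c.
Qed.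

Definition bip e S Q := forall a b, a \in S -> b \in Q -> e a b.

Lemma bip_notin e S Q a : irreflexive e -> bip e S Q -> a \in S -> a \notin Q.
Proof. by move=> ie SQ aS; apply/negP => /(SQ _ _ aS); rewrite ie. Qed.

(** Zigzag by induction: after [x], [t1], [a] the path continues in the complete bipartite graph
    without [x] and [t1]. *)
Lemma heads_T e S Q x t i : symmetric e -> irreflexive e -> bip e S Q ->
  x \in S -> t \in Q -> i < #|S| -> i < #|Q| ->
  upath e (S :|: Q) x t (1 + 2 * i).
Proof.
move=> se ie; elim: i S Q x => [|i IHi] S Q x SQ xS tQ iS iQ.
  apply: upath1; rewrite ?in_setU ?xS ?tQ ?orbT ?SQ //.
  by apply: contraTneq tQ => <-; apply: bip_notin SQ xS.
have [t1 t1Q t1t] := card_gt1_D1 tQ (leq_trans (ltn0Sn i : 1 < i.+2) iQ).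
have [a aS ax] := card_gt1_D1 xS (leq_trans (ltn0Sn i : 1 < i.+2) iS).
have H : upath e (S :\ x :|: Q :\ t1) a t (1 + 2 * i).
  apply: IHi => //.
  - by move=> u v /setD1P[_ uS] /setD1P[_ vQ]; apply: SQ.
  - by rewrite in_setD1 ax.
  - by rewrite in_setD1 eq_sym t1t.
  - exact: ltn_card_D1.
  - exact: ltn_card_D1.
have t1S : t1 \notin S by apply/negP => /(bip_notin ie SQ); rewrite t1Q.
have xQ := bip_notin ie SQ xS.
have et1a : e t1 a by rewrite se SQ.
have {}H : upath e (t1 |: (S :\ x :|: Q :\ t1)) t1 t (1 + 2 * i).+1.
  by apply: upath_cons et1a H; rewrite !inE eqxx (negbTE t1S) andbF.
have {}H : upath e (x |: (t1 |: (S :\ x :|: Q :\ t1))) x t (1 + 2 * i).+2.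
  apply: upath_cons (SQ _ _ xS t1Q) H.
  rewrite !inE eqxx /= (negbTE xQ) andbF !orbF.
  by apply: contraNneq xQ => ->.
rewrite (_ : 1 + 2 * i.+1 = (1 + 2 * i).+2); last by clear; lia.
apply: upath_sub H.
rewrite !subUset !sub1set !in_setU xS t1Q orbT /=.
rewrite (subset_trans (subD1set _ _) (subsetUl _ _)).
by rewrite (subset_trans (subD1set _ _) (subsetUr _ _)).
Qed.

(** The end [a] lies outside the bipartite graph so that it may be either a vertex taken out of the
    side of [x] or a vertex foreign to the core. *)
Lemma heads_S e S Q x a t i : symmetric e -> irreflexive e -> bip e S Q ->
  x \in S -> a \notin S :|: Q -> t \in Q -> e t a -> i < #|S| -> i < #|Q| ->
  upath e (a |: (S :|: Q)) x a (2 + 2 * i).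
Proof.
move=> se ie SQ xS aSQ tQ eta iS iQ.
have := upath_rev se (heads_T se ie SQ xS tQ iS iQ).
have eat : e a t by rewrite se.
by move/(upath_cons aSQ eat)/(upath_rev se).
Qed.

(* [Q] is one vertex too small for a path of length [2 * s + 1] in the bipartite
   graph; [v], placed between two of its neighbours in [S], replaces the missing
   vertex. *)
Lemma heads_extra e S Q x v t s : symmetric e -> irreflexive e -> bip e S Q ->
  x \in S -> t \in Q -> v \notin S :|: Q -> bip e [set v] Q ->
  1 < s -> #|S| = s.+1 -> #|Q| = s -> s <= dg e S v ->
  upath e (v |: (S :|: Q)) x t (1 + 2 * s).
Proof.
move=> se ie SQ xS tQ vSQ vQ s1 cS cQ dv.
have xQ := bip_notin ie SQ xS.
have QS a : a \in Q -> a \notin S.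
  by move=> aQ; apply/negP => aS; have := bip_notin ie SQ aS; rewrite aQ.
move: (vSQ); rewrite in_setU negb_or => /andP[vS vQ'].
have cSx : #|S :\ x| = s by move: cS; rewrite (cardsD1 x) xS => -[].
have vx : v != x by apply: contraNneq vS => ->.
have dx : dg e S v <= dg e (S :\ x) v + e v x.
  apply: leq_trans (dg_cover (A := S :\ x) (B := [set x]) _) _.
    by move=> u uS _; rewrite !inE uS andbT orNb.
  rewrite leq_add2l; case: (boolP (e v x)) => [_|nvx]; first exact: dg_set1.
  rewrite leqn0 -[_ == 0]negbK -lt0n; apply/negP => /dg_gt0P[q /set1P->].
  by rewrite (negbTE nvx).
(* If [v] sees [x], the path is [x], [v], [b] and then [1 + 2 * (s - 1)] edges. Otherwise [v] has at
   least two neighbours in [S :\ x], and the path is [x], [t1], [b], [v], [c] and then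
   [1 + 2 * (s - 2)] edges. *)
case: (boolP (e v x)) dx => [evx|nvx] dx.
  have /dg_gt0P[b bSx evb] : 0 < dg e (S :\ x) v.
    by move: s1 dv dx; clear; lia.
  have H : upath e (S :\ x :|: Q) b t (1 + 2 * s.-1).
    apply: heads_T => //; rewrite ?cSx ?cQ; try by move: s1; clear; lia.
    by move=> u w /setD1P[_ uS]; apply: SQ.
  have {}H : upath e (v |: (S :\ x :|: Q)) v t (1 + 2 * s.-1).+1.
    apply: upath_cons evb H; rewrite !inE negb_or negb_and negbK vQ' andbT.
    by rewrite (negbTE vS) orbT.
  have {}H : upath e (x |: (v |: (S :\ x :|: Q))) x t (1 + 2 * s.-1).+2.
    apply: upath_cons H; last by rewrite se.
    by rewrite !inE eqxx (negbTE xQ) eq_sym (negbTE vx).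
  rewrite (_ : 1 + 2 * s = (1 + 2 * s.-1).+2); last by move: s1; clear; lia.
  apply: upath_sub H; apply/subsetP => u; rewrite !inE.
  case/orP=> [/eqP->|]; rewrite ?xS ?orbT //; case: (u == v) => //=.
  by case: (u \in S); rewrite ?andbF.
have [b [c [bSx cSx' cb evb evc]]] : exists b c,
    [/\ b \in S :\ x, c \in S :\ x, c != b, e v b & e v c].
  apply: dg_gt1P; apply: leq_trans s1 _; apply: leq_trans dv _.
  by rewrite addn0 in dx.
have [t1 t1Q t1t] : exists2 t1, t1 \in Q & t1 != t by apply: card_gt1_D1; rewrite ?cQ.
move: (bSx) (cSx'); rewrite !in_setD1 => /andP[bx bS] /andP[cx cS'].
have H : upath e (S :\ x :\ b :|: Q :\ t1) c t (1 + 2 * s.-2).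
  apply: heads_T => //.
  - by move=> u w /setD1P[_ /setD1P[_ uS]] /setD1P[_ wQ]; apply: SQ.
  - by rewrite !inE cb cx.
  - by rewrite in_setD1 eq_sym t1t.
  - by rewrite (card_D1 bSx (n := s.-1)) ?cSx; move: s1; clear; lia.
  - by rewrite (card_D1 t1Q (n := s.-1)) ?cQ; move: s1; clear; lia.
set W := S :\ x :\ b :|: Q :\ t1 in H.
have {}H : upath e (v |: W) v t (1 + 2 * s.-2).+1.
  apply: upath_cons evc H.
  by rewrite !inE (negbTE vS) (negbTE vQ') !andbF.
have {}H : upath e (b |: (v |: W)) b t (1 + 2 * s.-2).+2.
  apply: upath_cons H; last by rewrite se.
  rewrite !inE eqxx (negbTE (bip_notin ie SQ bS)) !andbF /= !orbF.
  by apply: contraNneq vS => <-.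
have {}H : upath e (t1 |: (b |: (v |: W))) t1 t (1 + 2 * s.-2).+3.
  apply: upath_cons H; last by rewrite se SQ.
  rewrite !inE eqxx (negbTE (QS _ t1Q)) !andbF /= !orbF negb_or.
  apply/andP; split; first by apply: contraTneq bS => <-; apply: QS.
  by apply: contraNneq vQ' => <-.
have {}H : upath e (x |: (t1 |: (b |: (v |: W)))) x t (1 + 2 * s.-2).+4.
  apply: upath_cons H; last by rewrite SQ.
  rewrite !inE eqxx (negbTE xQ) !andbF /= !orbF !negb_or.
  apply/and3P; split; first by apply: contraNneq xQ => ->.
    by rewrite eq_sym.
  by rewrite eq_sym.
rewrite (_ : 1 + 2 * s = (1 + 2 * s.-2).+4); last by move: s1; clear; lia.
apply: upath_sub H; rewrite !subUset !sub1set !inE eqxx xS t1Q bS !orbT /=.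
apply/andP; split; apply/subsetP => u; rewrite !inE.
  by case/and3P=> _ _ ->; rewrite orbT.
by case/andP=> _ ->; rewrite !orbT.
Qed.
End Heads.

Ltac bcases := repeat (rewrite /= ?orbT ?orbF ?andbT ?andbF;
  first [done | match goal with
  | |- context [@eq_op ?t ?a ?b] => case: (@eq_op t a b)
  | |- context [@in_mem ?t ?a ?b] => case: (@in_mem t a b) end]).

(** * A minimal counterexample *)

Section Counterexample.
Variables (T : finType) (e : rel T) (V : {set T}) (x y : T) (k : nat).
Hypotheses (se : symmetric e) (ie : irreflexive e) (IH : theorem_below T #|V|)
  (R : rooted e V x y) (hdeg : min_deg e V x y k) (nxy : ~~ e x y) (k_gt1 : 1 < k)
  (ng : ~ paths2 e V x y k).
Implicit Types (A B C K L Q X S Z : {set T}) (a b u v w z t : T).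

(** * Excluding small separations *)

Lemma disjoint_setU A B C :
  [disjoint A & B :|: C] = [disjoint A & B] && [disjoint A & C].
Proof. by rewrite -!setI_eq0 setIUr setU_eq0. Qed.

Lemma degV v : v \in V -> v != x -> v != y -> 2 * k <= dg e V v.
Proof. by move=> vV vx vy; case: (hdeg vV vx vy) => // /(leq_trans k_gt1). Qed.

Lemma no_two_sep K z1 z2 t : K \subset V -> x \notin K -> y \notin K -> K != set0 ->
  t \in V -> t \notin K -> t != z1 -> t != z2 -> ~ border e V K [set z1; z2].
Proof.
move=> KV xK yK K0 tV tK t1 t2 bK; apply: ng.
apply: (two_sep se ie IH R hdeg (ltnW k_gt1) KV xK yK K0 _ bK).
by exists t.
Qed.

Lemma no_one_sep K z : K \subset V -> x \notin K -> y \notin K -> K != set0 ->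
  ~ border e V K [set z].
Proof.
move=> KV xK yK K0; have [_ _ _ _] := R; apply=> //.
apply/subsetP => v vK; rewrite !inE negb_or (subsetP KV) // andbT.
by apply/andP; split; [apply: contraNneq xK | apply: contraNneq yK] => <-.
Qed.

(* Deleting [c] costs at most one neighbour, whence [k - 1] paths. *)
Lemma part_paths2 K a b c : K \subset V -> x \notin K -> y \notin K -> K != set0 ->
  a \in V -> b \in V -> c \in V -> a \notin K -> b \notin K -> c \notin K ->
  a != b -> a != c -> b != c -> border e V K [set a; b; c] ->
  paths2 e (K :|: [set a; b]) a b k.-1.
Proof.
move=> KV xK yK K0 aV bV cV aK bK cK ab ac bc bd.
have WV : K :|: [set a; b] \subset V by rewrite !subUset !sub1set KV aV bV.
apply: IH => //.
- apply: proper_card; apply/properP; split=> //; exists c => //.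
  by rewrite !inE negb_or cK negb_or !(eq_sym c) ac bc.
- split; rewrite ?inE ?eqxx ?orbT //.
    case/set0Pn: K0 => v vK; apply/set0Pn; exists v; rewrite !inE vK andbT negb_or.
    by apply/andP; split; [apply: contraNneq aK | apply: contraNneq bK] => <-.
  move=> L z LK L0 bL.
  have {}LK : L \subset K.
    apply/subsetP => v /(subsetP LK); rewrite !inE => /andP[/norP[/negbTE-> /negbTE->]].
    by rewrite !orbF.
  have LV := subset_trans LK KV.
  have bL' : border e V L [set c; z].
    move=> v w vL wV evw; have := bd _ _ (subsetP LK _ vL) wV evw.
    rewrite !inE; case: (boolP (w == c)) => /=; first by rewrite !orbT.
    rewrite orbF => _ H; have := bL v w vL _ evw; rewrite !inE; exact.
  have nL v : v \notin K -> v \notin L by apply: contra => /(subsetP LK).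
  (* In the whole graph [L] is attached to [c] and [z] only; whichever of [a] and [b] differs from
     [z] shows that this 2-separation is proper. *)
  case: (eqVneq a z) => az.
    by apply: (no_two_sep (t := b)) bL' => //; rewrite ?nL // -az eq_sym.
  by apply: (no_two_sep (t := a)) bL'; rewrite ?nL.
- move=> v; rewrite !inE => /orP[vK|/orP[]/eqP->]; rewrite ?eqxx // => va vb.
  right; have := degV (subsetP KV _ vK).
  have -> : v != x by apply: contraNneq xK => <-.
  have -> : v != y by apply: contraNneq yK => <-.
  move=> /(_ isT isT) H; have := dg_set1 e v c.
  have : dg e V v <= dg e (K :|: [set a; b]) v + dg e [set c] v.
    apply: dg_cover => w wV evw; have := bd _ _ vK wV evw.
    by rewrite !inE !orbA.
  by move: H; clear; lia.
Qed.

(** Contracting [A] with [q] as its only attachment drops the edges from [K] to [x], at most one per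
    vertex, so [k - 1] paths remain available in [K]; two heads already make up for the missing
    one. *)
Lemma finish_via K A B q z h n m : K \subset V -> x \notin K -> y \notin K ->
  K != set0 -> A \subset V -> B \subset V -> z \in V -> z \notin K -> z \notin A ->
  [disjoint A & K] ->
  x \in A -> q \in A -> q != x -> border e V K [set x; q; z] ->
  (forall i, i < n -> upath e A x q (h + 2 * i)) -> upath e B z y m ->
  (forall w, w \in B -> w \in A :|: K -> False) -> 1 < n -> k < n + k.-1 -> False.
Proof.
move=> KV xK yK K0 AV BV zV zK zA dAK xA qA qx bd heads tail hB n1 kn; apply: ng.
have qz : q != z by apply: contraNneq zA => <-.
have xz : x != z by apply: contraNneq zA => <-.
have qK : q \notin K by rewrite (disjointFr dAK qA).
have sub L : L \subset K :|: [set z] -> z \notin L -> L \subset K.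
  move=> LC zL; apply/subsetP => v vL; have := subsetP LC _ vL; rewrite !inE.
  by case/orP=> // /eqP vz; rewrite -vz vL in zL.
have no_sep L w : L \subset K -> L != set0 -> ~ border e V L [set x; w].
  move=> LK L0 bL; have nL v : v \notin K -> v \notin L by apply: contra => /(subsetP LK).
  have LV := subset_trans LK KV.
  have qV := subsetP AV _ qA.
  case: (eqVneq q w) => qw.
    apply: (no_two_sep (t := z)) bL => //; rewrite ?nL //; first by rewrite eq_sym.
    by rewrite -qw eq_sym.
  by apply: (no_two_sep (t := q)) bL; rewrite ?nL.
apply: (@contract _ e V x y k (K :|: [set z]) A [set q] B h n k.-1 z m se ie IH) => //.
- by rewrite subUset KV sub1set.
- by rewrite disjoint_setU dAK disjoint_sym disjoints1.
- by rewrite sub1set.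
- by rewrite !inE eqxx orbT.
- have : x |: (q |: (K :|: [set z])) \subset V.
    by rewrite !subUset !sub1set KV zV !(subsetP AV).
  move/subset_leq_card; apply: leq_trans.
  rewrite !cardsU1 !inE (negbTE xK) (negbTE qK) (negbTE xz) (negbTE qz) eq_sym.
  by rewrite (negbTE qx).
- case/set0Pn: K0 => c cK; apply/set0Pn; exists c; rewrite !inE cK andbT.
  by apply: contraNneq zK => <-.
- by move=> q' i /set1P->; apply: heads.
- move=> w wB; rewrite setUA in_setU => /orP[wAK|/set1P//].
  by case: (hB w).
- move=> L LC zL bL; apply/eqP; apply: contraT => L0.
  have LK := sub _ LC zL.
  case: (no_sep _ q LK L0) => v w vL wV evw.
  have := bd _ _ (subsetP LK _ vL) wV evw; rewrite !inE.
  case: (boolP (w == x)) => /=; first by rewrite !orbT.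
  case: (boolP (w == q)) => /=; first by rewrite !orbT.
  by move=> _ _ wKz; have := bL _ _ vL _ evw; rewrite !inE; apply.
- move=> L w LC zL L0 _ bL; have LK := sub _ LC zL.
  apply: (no_sep _ w LK L0) => v u vL uV evu.
  have := bd _ _ (subsetP LK _ vL) uV evu; rewrite !inE.
  case: (boolP (u == x)) => /=; first by rewrite !orbT.
  move=> _ H; have := bL _ _ vL _ evu; rewrite !inE; apply.
  by move: H; case: (u \in K) => //=; case: (u == q); rewrite ?orbT ?orbF.
- move=> v vC vz; have vK : v \in K by move: vC; rewrite !inE (negbTE vz) orbF.
  right; have := degV (subsetP KV _ vK).
  have -> : v != x by apply: contraNneq xK => <-.
  have -> : v != y by apply: contraNneq yK => <-.
  move=> /(_ isT isT) H; have := dg_set1 e v x; have := dg_set1 e v q.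
  have : dg e V v <= dg e (K :|: [set z]) v + dg e [set q; x] v.
    apply: dg_cover => w wV evw; have := bd _ _ vK wV evw.
    by rewrite !inE; bcases.
  have : dg e [set q; x] v <= dg e [set q] v + dg e [set x] v.
    by apply: dg_cover => w; rewrite !inE.
  by case: (dg e [set q] v) => [|[]] //; move: H; clear; lia.
- by apply: leq_trans n1.
- by move: k_gt1; clear; lia.
Qed.


Lemma upath_component A u w n : upath e A u w n -> w \in component e A u.
Proof.
move=> [p [ep <- _ sp _]]; rewrite inE sp ?mem_last //=.
apply/connectP; exists p => //.
elim: p u ep sp => //= v p IHp u /andP[euv ep] sp.
rewrite {1}/induced /= euv !sp ?inE ?eqxx ?orbT //=.
by apply: IHp => // b bp; apply: sp; rewrite inE bp orbT.
Qed.

(** The [k - 1] paths from [x] to [a] through [K] serve as heads for the [k - 1] paths obtained in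
    [L]. Together they have [2 * k - 3] lengths, which reaches [k] once [k >= 3]. *)
Lemma in_series K L a z B m : 2 < k ->
  K \subset V -> x \notin K -> y \notin K -> K != set0 ->
  L \subset V -> x \notin L -> y \notin L -> L != set0 -> [disjoint K & L] ->
  a \in V -> z \in V -> a \notin K -> a \notin L -> z \notin K -> z \notin L ->
  a != x -> z != x -> a != z ->
  forall c, c \in V -> c \notin K -> c != a -> c != x ->
  border e V K [set x; a; c] -> border e V L [set x; a; z] ->
  upath e B z y m -> B \subset V ->
  (forall w, w \in B -> w \in K :|: [set x; a] -> False) -> [disjoint B & L] -> False.
Proof.
move=> k2 KV xK yK K0 LV xL yL L0 dKL aV zV aK aL zK zL ax zx az c cV cK ca cx.
move=> bK bL tail BV hB dBL.
have [xV _ _ _ _] := R.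
have [h [h2 heads]] : paths2 e (K :|: [set x; a]) x a k.-1.
  by apply: part_paths2 bK; rewrite // eq_sym.
apply: (@finish_via L (K :|: [set x; a]) B a z h k.-1 m) => //.
- by rewrite !subUset KV !sub1set xV aV.
- by rewrite !inE (negbTE zK) (negbTE zx) eq_sym (negbTE az).
- by rewrite disjoint_sym !disjoint_setU disjoint_sym dKL !(disjoint_sym L) !disjoints1 xL aL.
- by rewrite !inE eqxx orbT.
- by rewrite !inE eqxx !orbT.
- move=> w wB; rewrite in_setU => /orP[|wL]; first exact: hB.
  by rewrite (disjointFr dBL wB) in wL.
- by move: k2; clear; lia.
- by move: k2; clear; lia.
Qed.

(** [W] is what lies beyond [x], [a], [z]. If [z = y], or if [W] has a part not joined to [y] inside
    [W], a second set is attached to the same three vertices and can be put in series with [K].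
    Otherwise [W] is connected to [y], and [K] with [x] and [a] is contracted. *)
Lemma no_three_sep K a z t m : 2 < k ->
  K \subset V -> x \notin K -> y \notin K -> K != set0 ->
  a \in V -> z \in V -> a \notin K -> z \notin K ->
  a != x -> a != y -> z != x -> a != z ->
  t \in V -> t \notin K -> t != x -> t != a -> t != z -> t != y ->
  border e V K [set x; a; z] ->
  upath e (V :\: (K :|: [set x; a])) z y m -> False.
Proof.
move=> k2 KV xK yK K0 aV zV aK zK ax ay zx az tV tK tx ta tz ty bK tail.
have [xV yV xy _ _] := R.
pose W := V :\: (K :|: [set x; a; z]).
have WV : W \subset V by apply: subsetDl.
have noWK u w : u \in W -> w \in V -> e u w -> w \notin K.
  move=> uW wV euw; apply/negP => wK; rewrite se in euw.
  have := bK _ _ wK (subsetP WV _ uW) euw.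
  by move: uW; rewrite !inE; bcases.
have bW u w : u \in W -> w \in V -> e u w -> (w \in W) || (w \in [set x; a; z]).
  move=> uW wV euw; have := noWK u w uW wV euw.
  by rewrite !inE wV andbT; bcases.
have two L B j : L != set0 -> L \subset W -> y \notin L ->
    border e V L [set x; a; z] -> upath e B z y j -> B \subset V ->
    (forall w, w \in B -> w \in L :|: [set x; a] -> False) -> [disjoint B & K] -> False.
  move=> L0 LW yL bL tB BV hB dB.
  have nL v : v \notin W -> v \notin L by apply: contra => /(subsetP LW).
  apply: (@in_series L K a z B j) bL bK tB BV hB dB => //.
  - exact: subset_trans LW WV.
  - by rewrite nL // !inE eqxx orbT.
  - rewrite disjoint_subset; apply/subsetP => v /(subsetP LW).
    by rewrite !inE; case: (v \in K).
  - by rewrite nL // !inE eqxx !orbT.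
  - by rewrite nL // !inE eqxx !orbT.
  - by rewrite nL // !inE eqxx !orbT.
  - by rewrite eq_sym.
case: (eqVneq z y) => [zy|zy].
  apply: (two W [set y] 0) => //.
  - by apply/set0Pn; exists t; rewrite !inE !negb_or tK tx ta tz.
  - by rewrite !inE zy eqxx !orbT.
  - by rewrite zy; apply: upath0; rewrite inE.
  - by rewrite sub1set.
  - move=> w /set1P->; rewrite !inE zy eqxx !orbT /=.
    by rewrite (eq_sym y x) (eq_sym y a) (negbTE xy) (negbTE ay).
  - by rewrite disjoints1.
have yW : y \in W.
  by rewrite !inE !negb_or yV yK !(eq_sym y) xy ay zy.
pose W1 := component e W y.
have W1W : W1 \subset W := component_sub _ _ _.
have tailW1 : exists j, upath e (z |: W1) z y j.
  case: m tail => [[[|v q] [//= _ zy']]|m tail]; first by rewrite zy' eqxx in zy.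
  have [v ezv vy] := upath_behead tail.
  have {}vy : upath e W v y m.
    apply: upath_sub vy; apply/subsetP => w; rewrite !inE.
    by case/and3P=> wz; rewrite !negb_or wz => /and3P[-> -> ->] ->.
  have vW1 := upath_component (upath_rev se vy).
  have [j vj] := upath_in_component se yW vW1.
  by exists j.+1; apply: upath_cons ezv (upath_rev se vj); apply/negP => /(subsetP W1W);
     rewrite !inE eqxx !orbT.
case: (eqVneq (W :\: W1) set0) => [W2|W20]; last first.
  have [j tl] := tailW1.
  apply: (two (W :\: W1) (z |: W1) j) => //.
  - exact: subsetDl.
  - by rewrite inE negb_and negbK component_refl.
  - move=> u w; rewrite inE => /andP[uW1 uW] wV euw.
    case/orP: (bW _ _ uW wV euw) => [wW|->]; last by rewrite orbT.
    rewrite in_setD wW andbT; apply/orP; left; apply: contra uW1 => wW1.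
    rewrite se in euw.
    by have := component_closed wW1 uW euw; rewrite in_set0 orbF.
  - by rewrite subUset sub1set zV (subset_trans W1W).
  - move=> w; rewrite in_setU1 => /predU1P[->|wW1].
      by rewrite !inE eqxx !orbT andbF (negbTE zx) eq_sym (negbTE az).
    rewrite in_setU in_setD wW1 /= => H; have := subsetP W1W _ wW1.
    by move: H; rewrite !inE; bcases.
  - rewrite disjoint_subset; apply/subsetP => w; rewrite in_setU1 => /predU1P[->|]; first by rewrite inE.
    by move/(subsetP W1W); rewrite !inE; case: (w \in K).
have WW1 : W1 = W.
  by apply/eqP; rewrite eqEsubset W1W -setD_eq0 W2 eqxx.
have tW : t \in W by rewrite !inE !negb_or tV tK tx ta tz.
have rW : rconn e W y by rewrite -WW1; apply: component_rconn.
have [h [h2 heads]] : paths2 e (K :|: [set x; a]) x a k.-1.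
  by apply: part_paths2 bK; rewrite // eq_sym.
have WK w : w \in W -> w \notin K :|: [set x; a].
  by rewrite !inE; bcases.
apply: ng.
(* Vertices of [W] lose at most the two neighbours [x] and [z], which is exactly the price of
   passing from [k] to [k - 1]. *)
apply: (@contract _ e V x y k W (K :|: [set x; a]) [set a] [set y] h k.-1 k.-1 y 0 se ie IH) => //.
- by rewrite !subUset KV !sub1set xV aV.
- by rewrite sub1set.
- rewrite disjoint_sym disjoint_subset; apply/subsetP => w /WK; exact.
- by rewrite !inE eqxx orbT.
- by rewrite sub1set !inE eqxx !orbT.
- have : x |: (z |: W) \subset V by rewrite !subUset !sub1set WV xV zV.
  move/subset_leq_card; apply: leq_trans.
  by rewrite !cardsU1 !inE !eqxx !orbT /= eq_sym (negbTE zx).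
- by apply/set0Pn; exists t; rewrite in_setD1 ty.
- by move=> q i /set1P->; apply: heads.
- by apply: upath0; rewrite inE.
- by move=> w /set1P.
(* A bad [L] does not see [a], so it is attached to [x], [z], [w]. The roles of [a] and [z] are
   exchanged: [K] now leads from [x] to [z], and [L] from [z] to [w]. *)
- move=> L w LW yL L0 wW bL.
  have LV := subset_trans LW WV.
  have nL v : v \notin W -> v \notin L by apply: contra => /(subsetP LW).
  have xW : x \notin W by rewrite !inE eqxx orbT.
  have aW : a \notin W by rewrite !inE eqxx !orbT.
  have zW : z \notin W by rewrite !inE eqxx !orbT.
  case: (boolP (w \in L)) => wL.
    suff : L = set0 by move/eqP; rewrite (negbTE L0).
    apply: rW => // u v uL vW euv.
    have /(bL _ _ uL)/(_ euv) : v \in W :|: [set a] by rewrite in_setU vW.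
    by case/orP=> [->//|/set1P->]; rewrite wL.
  have bW' : border e W L [set w].
    by move=> u v uL vW euv; apply: (bL u v) => //; rewrite in_setU vW.
  have [j tl] := rconn_avoid se rW LW yW yL wW wL bW'.
  have bL' : border e V L [set x; z; w].
    move=> u v uL vV euv; have uW := subsetP LW _ uL.
    case/orP: (bW _ _ uW vV euv) => vW.
      have /(bL _ _ uL)/(_ euv) : v \in W :|: [set a] by rewrite in_setU vW.
      by rewrite !inE; bcases.
    case: (eqVneq v a) => [va|va]; last by move: vW; rewrite !inE (negbTE va); bcases.
    have /(bL _ _ uL)/(_ euv) : v \in W :|: [set a] by rewrite !inE va eqxx orbT.
    by rewrite !inE; bcases.
  have [h' [h2' heads']] : paths2 e (K :|: [set x; z]) x z k.-1.
    apply: (@part_paths2 K x z a); rewrite // 1?eq_sym //.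
    by move=> u v uK vV euv; have := bK _ _ uK vV euv; rewrite !inE; bcases.
  apply: (@finish_via L (K :|: [set x; z]) (W :\: L) z w h' k.-1 j) => //.
  + exact: nL.
  + by rewrite !subUset KV !sub1set xV zV.
  + exact: subset_trans (subsetDl _ _) WV.
  + exact: subsetP WV _ wW.
  + by move: wW; rewrite !inE; bcases.
  + rewrite disjoint_sym disjoint_subset; apply/subsetP => v /(subsetP LW).
    by rewrite !inE; bcases.
  + by rewrite !inE eqxx orbT.
  + by rewrite !inE eqxx !orbT.
  + by move=> v; rewrite !inE; bcases.
  + by move: k2; clear; lia.
  + by move: k2; clear; lia.
- move=> v vW vy; right; have vV := subsetP WV _ vW.
  have := degV vV _ vy.
  have -> : v != x by apply: contraTneq vW => ->; rewrite !inE eqxx !orbT.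
  move=> /(_ isT) H; have := dg_set1 e v x; have := dg_set1 e v z; have := dg_set1 e v a.
  have : dg e V v <= dg e W v + dg e [set a; x; z] v.
    apply: dg_cover => w wV evw; have := bW _ _ vW wV evw.
    by case: (w \in W) => //=; rewrite !inE; bcases.
  have : dg e [set a; x; z] v <= dg e [set a] v + dg e [set x; z] v.
    by apply: dg_cover => w; rewrite !inE; bcases.
  have : dg e [set x; z] v <= dg e [set x] v + dg e [set z] v.
    by apply: dg_cover => w; rewrite !inE; bcases.
  by case: (dg e [set a] v) => [|[]] //; move: H; clear; lia.
- by move: k2; clear; lia.
- by move: k2; clear; lia.
- by move: k2; clear; lia.
Qed.

(* Contracting [S] and deleting [x] costs at most [s <= 2 * (s - 1)] neighbours,
   which is where [1 < s] is needed. *)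
Lemma no_bad K A B S w t s m : 1 < s ->
  K \subset V -> x \notin K -> y \notin K -> K != set0 -> A \subset V -> B \subset V ->
  [disjoint A & K] -> x \in A -> S \subset A -> w \in V -> w \notin A -> w \notin K ->
  border e V K (w |: (x |: S)) ->
  (forall L, L \subset K -> L != set0 -> ~ border e V L (x |: S)) ->
  (forall q i, q \in S -> i < s -> upath e A x q (2 + 2 * i)) ->
  (forall v, v \in K -> dg e S v + dg e [set x] v <= s.+1) ->
  upath e B w y m -> (forall v, v \in B -> v \in A :|: K -> False) ->
  t \in A -> t != x -> False.
Proof.
move=> s1 KV xK yK K0 AV BV dAK xA SA wV wA wK bK hK heads hS tail hB tA tx; apply: ng.
have xw : x != w by apply: contraNneq wA => <-.
have tw : t != w by apply: contraNneq wA => <-.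
have tK : t \notin K by rewrite (disjointFr dAK tA).
have sub L : L \subset w |: K -> w \notin L -> L \subset K.
  move=> LC zL; apply/subsetP => v vL; have := subsetP LC _ vL; rewrite !inE.
  by case/orP=> // /eqP vz; rewrite -vz vL in zL.
(* The subtraction truncates; the maximum keeps [k'] positive, and the value 1 is covered by the
   escape in the degree condition. *)
apply: (@contract _ e V x y k (w |: K) A S B 2 s (maxn 1 (k.+1 - s)) w m se ie IH) => //.
- by rewrite subUset KV sub1set wV.
- by rewrite disjoint_setU dAK disjoint_sym disjoints1 wA.
- by rewrite !inE eqxx.
- have : x |: (t |: (w |: K)) \subset V.
    by rewrite !subUset !sub1set KV wV !(subsetP AV).
  move/subset_leq_card; apply: leq_trans.
  rewrite !cardsU1 !inE (negbTE xK) (negbTE tK) (negbTE xw) (negbTE tw) eq_sym.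
  by rewrite (negbTE tx) wK.
- case/set0Pn: K0 => c cK; apply/set0Pn; exists c; rewrite !inE cK orbT andbT.
  by apply: contraNneq wK => <-.
- move=> v vB; rewrite !in_setU => /orP[vA|/orP[/set1P//|vK]];
  by case: (hB v vB); rewrite in_setU ?vA ?vK ?orbT.
- move=> L LC wL bL; apply/eqP; apply: contraT => L0; have LK := sub _ LC wL.
  case: (hK _ LK L0) => v u vL uV evu.
  have := bK _ _ (subsetP LK _ vL) uV evu; have := bL v u vL _ evu.
  by rewrite !inE; bcases; move=> /(_ isT).
- move=> L z LC wL L0 zC bL; have LK := sub _ LC wL.
  have nL v : v \notin K -> v \notin L by apply: contra => /(subsetP LK).
  have tz : t != z.
    by apply: contraTneq zC => <-; rewrite in_setU1 (negbTE tw) (negbTE tK).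
  apply: (no_two_sep (K := L) (z1 := x) (z2 := z) (t := t)) => //; rewrite ?nL //.
  + exact: subset_trans LK KV.
  + exact: (subsetP AV).
  move=> v u vL uV evu.
  have := bK _ _ (subsetP LK _ vL) uV evu; have := bL v u vL _ evu.
  by rewrite !inE; bcases; move=> /(_ isT).
- move=> v; rewrite in_setU1 => /predU1P[->|vK _]; first by rewrite eqxx.
  have := degV (subsetP KV _ vK).
  have -> : v != x by apply: contraNneq xK => <-.
  have -> : v != y by apply: contraNneq yK => <-.
  move=> /(_ isT isT) H; have := hS v vK.
  have : dg e V v <= dg e (w |: K) v + dg e (x |: S) v.
    apply: dg_cover => u uV evu; have := bK _ _ vK uV evu.
    by rewrite !inE; bcases.
  have : dg e (x |: S) v <= dg e S v + dg e [set x] v.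
    by apply: dg_cover => u; rewrite !inE; bcases.
  have := dg_set1 e v x.
  move: H s1; case: (posnP (dg e S v)) => [->|_]; clear; lia.
- by move: s1; clear; lia.
- by clear; lia.
- by clear; lia.
Qed.

(** * The maximal bipartite core and the ways out of it *)

Definition common S := [set t in V | (t != y) && [forall a in S, e a t]].

Lemma commonP S t : reflect [/\ t \in V, t != y & forall a, a \in S -> e a t] (t \in common S).
Proof.
rewrite inE; apply: (iffP and3P) => -[tV ty H]; split=> //.
  by move=> a aS; move/forallP/(_ a): H; rewrite aS.
by apply/forallP => a; apply/implyP => aS; apply: H.
Qed.

Lemma common_sub S : common S \subset V.
Proof. by apply/subsetP => t /commonP[]. Qed.

Lemma y_common S : y \notin common S.
Proof. by apply/negP => /commonP[_]; rewrite eqxx. Qed.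

Lemma bip_common S : bip e S (common S).
Proof. by move=> a b aS /commonP[_ _]; apply. Qed.

(** Absence of a [K_{s+2,s+2}] in the graph without [y] that has [x] on the side [S]. *)
Definition maximal_core s := forall S Q, x \in S -> S \subset V -> y \notin S ->
  Q \subset V -> y \notin Q -> bip e S Q -> #|S| = s.+2 -> #|Q| < s.+2.

Section Core.
Variables (s : nat) (S : {set T}).
Hypotheses (xS : x \in S) (SV : S \subset V) (yS : y \notin S) (cS : #|S| = s.+1)
  (cQ : s < #|common S|) (smax : maximal_core s).
Let Q := common S.

(** Otherwise [v |: S] and the neighbours of [v] in [Q] would form a larger core. *)
Lemma dg_common v : v \in V -> v != y -> v \notin S -> dg e Q v <= s.+1.
Proof.
move=> vV vy vS; rewrite -ltnS; apply: (smax (S := v |: S)).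
- by rewrite !inE xS orbT.
- by rewrite subUset sub1set vV.
- by rewrite in_setU1 negb_or eq_sym vy.
- by apply/subsetP => u; rewrite inE => /andP[/(subsetP (common_sub S))].
- by rewrite inE (negbTE (y_common S)).
- move=> a b; rewrite in_setU1 => /predU1P[->|aS]; rewrite inE => /andP[bQ evb] //.
  exact: bip_common bQ.
- by rewrite cardsU1 vS cS.
Qed.

(** A vertex seeing all [s + 1] vertices of [S] would belong to [Q]. *)
Lemma dg_core v : v \in V -> v != y -> v \notin Q -> dg e S v <= s.
Proof.
move=> vV vy; apply: contraR; rewrite -ltnNge => H; apply/commonP; split=> // a aS.
have /eqP E : [set u in S | e v u] == S.
  rewrite eqEcard cS H andbT; apply/subsetP => u; by rewrite inE => /andP[].
by move: aS; rewrite -E inE se => /andP[].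
Qed.

Lemma core_notin v : v \in S -> v \notin Q.
Proof. exact: bip_notin ie (@bip_common S). Qed.

Lemma core_heads t i : t \in Q -> i <= s -> upath e (S :|: Q) x t (1 + 2 * i).
Proof.
move=> tQ si; apply: heads_T => //; first exact: bip_common.
  by rewrite cS.
by apply: leq_trans cQ.
Qed.

(** [q] is taken out of [S] and reached by a last edge from [Q'], so [s] vertices in [Q'] are
    enough. This keeps the lemma usable after an exit has been removed from [Q]. *)
Lemma core_heads_S Q' q i : Q' \subset Q -> s <= #|Q'| -> q \in S -> q != x -> i < s ->
  upath e (S :|: Q') x q (2 + 2 * i).
Proof.
move=> Q'Q sQ' qS qx si.
have [t tQ'] : exists t, t \in Q'.
  by apply/set0Pn; rewrite -card_gt0; apply: leq_trans sQ'; apply: leq_ltn_trans si.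
have bSQ : bip e (S :\ q) Q'.
  by move=> a b /setD1P[_ aS] bQ; apply: (bip_common aS); apply: (subsetP Q'Q).
have qQ' : q \notin Q' by apply: contra (core_notin qS) => /(subsetP Q'Q).
have H : upath e (q |: (S :\ q :|: Q')) x q (2 + 2 * i).
  apply: (heads_S se ie bSQ (t := t)) => //.
  - by rewrite in_setD1 eq_sym qx.
  - by rewrite in_setU in_setD1 eqxx.
  - by rewrite se (bip_common qS) // (subsetP Q'Q).
  - by rewrite (card_D1 qS cS).
  - exact: leq_trans sQ'.
by apply: upath_sub H; rewrite setUA setD1K.
Qed.

Lemma core_SQ : S :|: Q \subset V.
Proof. by rewrite subUset SV common_sub. Qed.

(** The [s + 1] heads ending in [t], prolonged by the tail, already satisfy the length condition; in
    a counterexample they must be fewer than [k]. *)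
Lemma core_k_large t B m : t \in Q -> upath e B t y m -> B \subset V ->
  (forall w, w \in B -> w \in S :|: Q -> w = t) -> s.+1 < k.
Proof.
move=> tQ tail BV hB; rewrite ltnNge; apply/negP => ks; apply: ng.
exists (1 + m); split.
  case: m tail => [[[|v p] [//= _ ty]]|//].
  by have := y_common S; rewrite -ty tQ.
move=> i ik; have is_ : i <= s by rewrite -ltnS (leq_trans ik).
rewrite -addnA (addnC m) addnA; apply: upath_sub (upath_cat (core_heads tQ is_) tail _).
  by rewrite subUset core_SQ.
by move=> w w1 w2; apply: hB.
Qed.

(** Otherwise the component [C] of [y] off the core has a second vertex, and the whole core can be
    contracted with [y] as the other root. *)
Lemma core_nbr_y c : c \in V -> e y c -> c \in S :|: Q.
Proof.
move=> cV eyc; apply: contraT => cSQ; have [xV yV xy _ _] := R.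
pose W := V :\: (S :|: Q); pose C := component e W y.
have yW : y \in W by rewrite in_setD in_setU negb_or yS yV andbT (y_common S).
have cW : c \in W by rewrite in_setD cSQ.
have yC : y \in C by apply: component_refl.
have cC : c \in C.
  by have := component_closed yC cW eyc; rewrite in_set0 orbF.
have CW : C \subset W := component_sub _ _ _.
have WV : W \subset V := subsetDl _ _.
have CV := subset_trans CW WV.
have rC : rconn e C y by apply: component_rconn.
have CSQ v : v \in C -> v \notin S :|: Q by move/(subsetP CW); rewrite inE => /andP[].
have CS v : v \in C -> v \notin S by move/CSQ; rewrite in_setU => /norP[].
have CQ v : v \in C -> v \notin Q by move/CSQ; rewrite in_setU => /norP[].
have bC v w : v \in C -> w \in V -> e v w -> [|| w \in C, w \in S | w \in Q].
  move=> vC wV evw; case: (boolP (w \in W)) => wW.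
    by have := component_closed vC wW evw; rewrite in_set0 orbF => ->.
  by move: wW; rewrite in_setD wV andbT negbK in_setU => ->; rewrite orbT.
have [t tQ] : exists t, t \in Q by apply/set0Pn; rewrite -card_gt0; apply: leq_trans cQ.
have tS : t \notin S by apply/negP => /core_notin; rewrite tQ.
have tV : t \in V := subsetP (common_sub S) _ tQ.
have ty : t != y by apply: contraTneq tQ => ->; apply: y_common.
have tx : t != x by apply: contraNneq tS => ->.
have dSQC : [disjoint S :|: Q & C].
  by rewrite disjoint_sym disjoint_subset; apply/subsetP => v /CSQ.
case: ng.
(* There are [s + 1] heads of lengths 1, 3, ...; a vertex of [C] loses at most [s] neighbours in
   [S], and at most [s + 1] neighbours in [Q] shrink to one. *)
apply: (@contract _ e V x y k C (S :|: Q) Q [set y] 1 s.+1 (maxn 1 (k - s)) y 0 se ie IH) => //.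
- exact: core_SQ.
- by rewrite sub1set.
- by rewrite inE xS.
- exact: subsetUr.
- have : x |: (t |: C) \subset V by rewrite !subUset !sub1set xV tV.
  move/subset_leq_card; apply: leq_trans.
  rewrite !cardsU1 in_setU1 negb_or eq_sym tx.
  have -> : x \notin C by apply/negP => /CS; rewrite xS.
  by have -> : t \notin C by apply/negP => /CQ; rewrite tQ.
- apply/set0Pn; exists c; rewrite in_setD1 cC andbT.
  by apply: contraTneq eyc => ->; rewrite ie.
- by move=> q i qQ; rewrite ltnS; apply: core_heads.
- by apply: upath0; rewrite inE.
- by move=> w /set1P.
- move=> K z KC yK K0 zC bK.
  have KV := subset_trans KC CV.
  have xK : x \notin K by apply/negP => /(subsetP KC)/CS; rewrite xS.
  have tK : t \notin K by apply/negP => /(subsetP KC)/CQ; rewrite tQ.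
  have zV := subsetP CV _ zC.
  have bK' : border e V K (z |: S).
    move=> v w vK wV evw; have vC := subsetP KC _ vK.
    have H : w \in C :|: Q -> (w \in K) || (w \in z |: S).
      by move=> wCQ; have := bK _ _ vK wCQ evw; rewrite !inE; bcases.
    case/or3P: (bC _ _ vC wV evw) => [wC|wS|wQ]; [| |].
    + by apply: H; rewrite inE wC.
    + by rewrite !inE wS !orbT.
    + by apply: H; rewrite inE wQ orbT.
  have bKC : border e C K [set z].
    by move=> v w vK wC evw; apply: (bK v w) => //; rewrite inE wC.
  have zK : z \notin K.
    apply/negP => zK; case/negP: K0; apply/eqP; apply: rC => // v w vK wC evw.
    by case/orP: (bKC _ _ vK wC evw) => [->//|/set1P->]; rewrite zK.
  have [m tail] := rconn_avoid se rC KC yC yK zC zK bKC.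
  have xz : x != z by apply: contraTneq xS => ->; apply: CS.
  have tz : t != z by apply: contraTneq tQ => ->; apply: CQ.
  case: (ltngtP s 1) => s1.
  + have Sx : S = [set x].
      apply/eqP; rewrite eq_sym eqEcard sub1set xS cards1 cS.
      by case: s s1.
    apply: (no_two_sep (K := K) (z1 := z) (z2 := x) (t := t)) => //.
    by move: bK'; rewrite Sx.
  + have SxQ : S :\ x \subset S :|: Q by apply: subset_trans (subD1set _ _) (subsetUl _ _).
    apply: (@no_bad K (S :|: Q) (C :\: K) (S :\ x) z t s m) => //.
    * exact: core_SQ.
    * exact: subset_trans (subsetDl _ _) CV.
    * exact: disjointWr KC dSQC.
    * by rewrite inE xS.
    * exact: CSQ.
    * by rewrite setD1K.
    * move=> L LK L0; rewrite setD1K // => bL; case/negP: L0; apply/eqP.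
      have LC := subset_trans LK KC.
      apply: rC => //; first by apply: contra yK => /(subsetP LK).
      move=> v w vL wC evw; have := bL _ _ vL (subsetP CV _ wC) evw.
      by rewrite (negbTE (CS _ wC)) in_set0.
    * move=> q i /setD1P[qx qS] si; apply: core_heads_S => //; exact: ltnW cQ.
    * move=> v vK; have vC := subsetP KC _ vK.
      have : dg e S v <= s.
        by apply: dg_core (CQ _ vC); [exact: subsetP CV _ vC | apply: contraNneq yK => <-].
      have := dg_sub e v (subD1set S x); have := dg_set1 e v x; clear; lia.
    * move=> v /setDP[vC vK]; rewrite in_setU (negbTE vK) orbF => vSQ.
      by have := CSQ _ vC; rewrite vSQ.
    * by rewrite in_setU tQ orbT.
  + have [a aS ax] : exists2 a, a \in S & a != x by apply: card_gt1_D1; rewrite ?cS ?s1.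
    have Sxa : S = [set x; a].
      apply/eqP; rewrite eq_sym eqEcard subUset !sub1set xS aS cS s1 cards2.
      by rewrite eq_sym ax.
    have aV := subsetP SV _ aS.
    have ay : a != y by apply: contraNneq yS => <-.
    have ta : t != a by apply: contraNneq tS => ->.
    have az : a != z by apply: contraTneq aS => ->; apply: CS.
    have aK : a \notin K by apply/negP => /(subsetP KC)/CS; rewrite aS.
    (* The series argument needs [k >= 3]. If [k = 2], an edge from [Q] to [C] would give
       [s + 1 = 2 < k]; without such an edge the two vertices of [S] separate [Q] from [C]. *)
    case: (leqP k 2) => k2; last first.
      apply: (@no_three_sep K a z t m) => //; first by rewrite eq_sym.
        by move: bK'; rewrite Sxa setUC.
      apply: upath_sub tail; apply/subsetP => v /setDP[vC vK].
      rewrite in_setD (subsetP CV) // andbT in_setU (negbTE vK) /= -Sxa.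
      exact: CS.
    case: (boolP [exists t1 in Q, [exists c1 in C, e t1 c1]]).
      case/existsP => t1 /andP[t1Q /existsP[c1 /andP[c1C et1c1]]].
      have [j yc1] := upath_in_component se yW c1C.
      have t1C : t1 \notin C by apply: contraTN t1Q; apply: CQ.
      have := core_k_large t1Q (upath_cons t1C et1c1 (upath_rev se yc1)) _ _.
      rewrite subUset sub1set CV (subsetP (common_sub S)) // => /(_ isT).
      have : (forall w, w \in t1 |: component e W y -> w \in S :|: Q -> w = t1).
        move=> w; rewrite in_setU1 => /predU1P[->//|wC wSQ].
        by have := CSQ _ wC; rewrite wSQ.
      by move=> H /(_ H); rewrite s1 ltnNge k2.
    move=> noadj; pose L := V :\: (C :|: S).
    apply: (no_two_sep (K := L) (z1 := x) (z2 := a) (t := y)) => //.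
    * exact: subsetDl.
    * by rewrite in_setD in_setU xS orbT.
    * by rewrite in_setD in_setU yC.
    * apply/set0Pn; exists t; rewrite in_setD in_setU tV (negbTE tS) orbF andbT.
      by apply: contraTN tQ; apply: CQ.
    * by rewrite in_setD in_setU yC.
    * by rewrite eq_sym.
    * by rewrite eq_sym.
    move=> v w; rewrite in_setD in_setU => /andP[/norP[vC vS] vV] wV evw.
    rewrite -Sxa in_setD in_setU wV andbT.
    case: (boolP (w \in S)) => wS; rewrite ?orbT // !orbF.
    apply: contra noadj => wC; rewrite se in evw.
    have := bC _ _ wC vV evw; rewrite (negbTE vC) (negbTE vS) /= => vQ.
    apply/existsP; exists v; rewrite vQ; apply/existsP; exists w.
    by rewrite wC se evw.
- move=> v vC vy; have vV := subsetP CV _ vC.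
  have := degV vV _ vy.
  have -> : v != x by apply: contraTneq vC => ->; apply/negP => /CS; rewrite xS.
  move=> /(_ isT) H; have := dg_core vV vy (CQ _ vC); have := dg_common vV vy (CS _ vC).
  have : dg e V v <= dg e C v + dg e (S :|: Q) v.
    by apply: dg_cover => w wV evw; rewrite in_setU; apply: bC evw.
  have : dg e (S :|: Q) v <= dg e S v + dg e Q v.
    by apply: dg_cover => w; rewrite in_setU.
  by move: H; case: (posnP (dg e Q v)) => [->|_]; clear; lia.
- by clear; lia.
- by clear; lia.
Qed.

(** The exit [t0] leaves [Q], becomes the second root and is followed by the edge to [y]. The
    neighbour [u0] gives the contracted graph a vertex besides its roots, and [Z] holds extra
    vertices that lengthen the heads. The degree hypothesis is the budget [2 * (n - 1)], with one
    unit refunded when [Q :\ t0] is seen. *)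
Lemma exit_core t0 u0 Z n : t0 \in Q -> e y t0 -> Z \subset V ->
  [disjoint Z & S :|: Q] -> y \notin Z -> 0 < n -> n <= k ->
  (forall q i, q \in Q :\ t0 -> i < n ->
     upath e (S :|: Q :\ t0 :|: Z) x q (1 + 2 * i)) ->
  u0 \in V -> u0 \notin S :|: Q -> u0 \notin Z -> u0 != y -> e t0 u0 ->
  (forall v, v \in V -> v \notin S :|: Q -> v \notin Z -> v != y ->
     dg e S v + dg e Z v + dg e (Q :\ t0) v <= 2 * n.-1 + (0 < dg e (Q :\ t0) v)) ->
  (forall K w m, K \subset V -> K != set0 -> x \notin K -> y \notin K ->
     [disjoint S :|: Q :|: Z & K] -> w \in V -> w \notin K ->
     w \notin S :|: Q :\ t0 :|: Z -> w != y ->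
     border e V K (w |: (S :|: Z)) ->
     (forall L, L \subset K -> L != set0 -> ~ border e V L (S :|: Z)) ->
     upath e (V :\: (K :|: (S :|: Q :\ t0 :|: Z))) w y m -> False) ->
  False.
Proof.
move=> t0Q eyt0 ZV dZ yZ n0 nk heads u0V u0SQ u0Z u0y et0u0 loss hbad.
have [xV yV xy _ _] := R.
pose A := S :|: Q :\ t0 :|: Z; pose W := V :\: (y |: (t0 |: A)).
pose D := component e W u0; pose C := t0 |: D.
have t0V := subsetP (common_sub S) _ t0Q.
have t0y : t0 != y by apply: contraTneq t0Q => ->; apply: y_common.
have t0S : t0 \notin S by apply/negP => /core_notin; rewrite t0Q.
have t0Z : t0 \notin Z.
  by apply/negP => /(disjointFr dZ); rewrite in_setU t0Q orbT.
have SQA : S :|: Q :|: Z = t0 |: A.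
  by apply/setP => v; rewrite !in_setU in_setD1 in_set1; case: eqP => // ->; rewrite t0Q orbT.
have inW v : (v \in W) = [&& v \in V, v != y, v \notin S :|: Q & v \notin Z].
  by rewrite in_setD in_setU1 -SQA (in_setU v _ Z) !negb_or andbC.
have u0W : u0 \in W by rewrite inW u0V u0y u0SQ.
have u0D : u0 \in D by apply: component_refl.
have DW : D \subset W := component_sub _ _ _.
have WV : W \subset V := subsetDl _ _.
have DV := subset_trans DW WV.
have CV : C \subset V by rewrite subUset sub1set t0V.
have AV : A \subset V.
  rewrite !subUset SV ZV andbT /=; apply: subset_trans (subD1set _ _) (common_sub S).
have Dn v : v \in D -> v \notin y |: (t0 |: A).
  by move/(subsetP DW); rewrite in_setD => /andP[].
have yC : y \notin C.
  rewrite in_setU1 negb_or eq_sym t0y; apply/negP => /Dn; by rewrite in_setU1 eqxx.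
have t0D : t0 \notin D by apply/negP => /Dn; rewrite !in_setU1 eqxx orbT.
have t0A : t0 \notin A.
  by rewrite !in_setU in_setD1 eqxx /= (negbTE t0S) (negbTE t0Z).
have AC v : v \in A -> v \notin C.
  move=> vA; rewrite in_setU1 negb_or; apply/andP; split.
    by apply: contraNneq t0A => <-.
  by apply/negP => /Dn; rewrite !in_setU1 vA !orbT.
(* All neighbours of [y] lie in the core, so leaving [y] out of the contracted graph costs no
   degree. *)
have nyD v : v \in D -> ~~ e v y.
  move=> vD; apply/negP => evy; rewrite se in evy.
  have := core_nbr_y (subsetP DV _ vD) evy.
  by have := subsetP DW _ vD; rewrite inW => /and4P[_ _ /negbTE->].
have bD v w : v \in D -> w \in V -> e v w -> (w \in C) || (w \in A).
  move=> vD wV evw; case: (boolP (w \in W)) => wW.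
    by have := component_closed vD wW evw; rewrite in_set0 orbF => wD; rewrite in_setU1 wD orbT.
  move: wW; rewrite in_setD wV andbT negbK !in_setU1 => /or3P[/eqP wy|->|->]; rewrite ?orbT //.
  by have := nyD v vD; rewrite -wy evw.
have sub L : L \subset C -> t0 \notin L -> L \subset D.
  move=> LC zL; apply/subsetP => v vL; have := subsetP LC _ vL; rewrite in_setU1.
  by case/orP=> // /eqP vz; rewrite -vz vL in zL.
have rC : rconn e C t0.
  move=> L LC t0L bL; have LD := sub L LC t0L.
  case: (boolP (u0 \in L)) => u0L.
    have := bL _ t0 u0L; rewrite se et0u0 (negbTE t0L) in_set0 setU11.
    by move/(_ isT isT).
  apply: (component_rconn se u0W LD u0L) => v w vL wD evw.
  by apply: bL evw => //; rewrite in_setU1 wD orbT.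
have xS' : x \in A by rewrite !in_setU xS.
apply: ng.
apply: (@contract _ e V x y k C A (Q :\ t0) [set t0; y] 1 n (k.+1 - n) t0 1 se ie IH) => //.
- by rewrite subUset !sub1set t0V.
- by rewrite disjoint_subset; apply/subsetP => v /AC.
- by rewrite /A -setUA setUCA subsetUl.
- exact: setU11.
- have : x |: (y |: C) \subset V.
    by rewrite subUset sub1set xV subUset sub1set yV.
  move/subset_leq_card; apply: leq_trans.
  by rewrite !cardsU1 in_setU1 negb_or xy yC (AC x xS').
- apply/set0Pn; exists u0; rewrite in_setD1 in_setU1 u0D orbT andbT.
  by apply: contraNneq t0D => <-.
- by apply: upath1; rewrite ?set21 ?set22 // se.
- move=> w; rewrite in_set2 => /orP[/eqP->//|/eqP->].
  rewrite in_setU (negbTE yC) orbF !in_setU in_setD1 (negbTE yS) (negbTE yZ).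
  by rewrite (negbTE (y_common S)) andbF.
- move=> K w KC t0K K0 wC bK.
  have KD := sub K KC t0K; have KV := subset_trans KC CV.
  have bKC : border e C K [set w].
    by move=> v u vK uC evu; apply: (bK v u) => //; rewrite in_setU uC.
  have wK : w \notin K.
    apply/negP => wK; case/negP: K0; apply/eqP; apply: rC => // v u vK uC evu.
    by case/orP: (bKC _ _ vK uC evu) => [->//|/set1P->]; rewrite wK.
  have [m tail] := rconn_avoid se rC KC (setU11 _ _) t0K wC wK bKC.
  have et0y : e t0 y by rewrite se.
  have wA : w \notin A by apply: contraL wC; apply: AC.
  have xK : x \notin K by apply: contra (AC x xS') => /(subsetP KC).
  have yK : y \notin K by apply: contra yC => /(subsetP KC).
  have wy : w != y by apply: contraTneq wC => ->.
  have AK v : v \in A -> v \notin K by move/AC; apply: contra => /(subsetP KC).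
  apply: (hbad K w (m + 1)) => //.
  + rewrite SQA disjoint_subset; apply/subsetP => v; rewrite in_setU1.
    by case/orP=> [/eqP->//|/AK].
  + exact: subsetP CV _ wC.
  + move=> v u vK uV evu; have vD := subsetP KD _ vK.
    have H : u \in C :|: Q :\ t0 -> (u \in K) || (u \in w |: (S :|: Z)).
      move=> uCQ; have := bK _ _ vK uCQ evu.
      by rewrite in_set1 in_setU1 => /orP[->//|->]; rewrite orbT.
    case/orP: (bD _ _ vD uV evu) => [uC|uA]; first by apply: H; rewrite in_setU uC.
    case/setUP: uA => [/setUP[uS|uQ]|uZ].
    * by rewrite !in_setU uS !orbT.
    * by apply: H; rewrite in_setU uQ orbT.
    * by rewrite !in_setU uZ !orbT.
  + move=> L LK L0 bL; case/negP: L0; apply/eqP; apply: rC.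
    * exact: subset_trans LK KC.
    * by apply: contra t0K => /(subsetP LK).
    move=> v u vL uC evu; have := bL _ _ vL (subsetP CV _ uC) evu.
    case/orP=> [->//|uSZ]; suff uA : u \in A by have := AC u uA; rewrite uC.
    by move: uSZ; rewrite !in_setU; case: (u \in S); case: (u \in Z); rewrite ?orbT.
  + have yy : upath e [set y] y y 0 by apply: upath0; rewrite in_set1.
    have dy : [disjoint C :\: K & [set y]].
      by rewrite disjoint_sym disjoints1 in_setD (negbTE yC) andbF.
    apply: upath_sub (upath_edge_cat tail et0y yy dy).
    apply/subsetP => v; rewrite in_setU in_set1 in_setD => /orP[/andP[vK vC]|/eqP->].
      rewrite in_setD (subsetP CV) // andbT in_setU negb_or vK /=.
      by apply: contraL vC; apply: AC.
    rewrite in_setD yV andbT !in_setU in_setD1 (negbTE yS) (negbTE yZ) (negbTE yK).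
    by rewrite (negbTE (y_common S)) andbF.
- move=> v vC vt0; right.
  have vD : v \in D by move: vC; rewrite in_setU1 (negbTE vt0).
  have := subsetP DW _ vD; rewrite inW => /and4P[vV vy vSQ vZ].
  have := degV vV _ vy.
  have -> : v != x by apply: contraTneq vC => ->; apply: AC.
  move=> /(_ isT) H; have := loss v vV vSQ vZ vy.
  have : dg e V v <= dg e C v + dg e A v by apply: dg_cover => w; apply: bD.
  have : dg e A v <= dg e (S :|: Q :\ t0) v + dg e Z v.
    by apply: dg_cover => w wA _; rewrite -in_setU.
  have : dg e (S :|: Q :\ t0) v <= dg e S v + dg e (Q :\ t0) v.
    by apply: dg_cover => w; rewrite in_setU.
  by move: H n0 nk; clear; lia.
- by move: nk; clear; lia.
- by move: nk; clear; lia.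
Qed.
(* Rules out the sets which keep the contraction in [exit_core] from being
   2-connected. *)
Definition no_obstruction t0 Z := forall K w m, K \subset V -> K != set0 ->
  x \notin K -> y \notin K -> [disjoint S :|: Q :|: Z & K] ->
  w \in V -> w \notin K -> w \notin S :|: Q :\ t0 :|: Z -> w != y ->
  border e V K (w |: (S :|: Z)) ->
  (forall L, L \subset K -> L != set0 -> ~ border e V L (S :|: Z)) ->
  upath e (V :\: (K :|: (S :|: Q :\ t0 :|: Z))) w y m -> False.

Lemma dg_D1 A v z : z \in A -> dg e A v = dg e (A :\ z) v + dg e [set z] v.
Proof.
move=> zA; apply/eqP; rewrite eqn_leq; apply/andP; split.
  by apply: dg_cover => w wA _; rewrite !inE wA andbT orNb.
rewrite /dg -cardsUI [X in _ + X](_ : _ = 0) ?addn0.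
  apply: subset_leq_card; apply/subsetP => w; rewrite !inE.
  by case/orP=> [/andP[/andP[_ ->] ->//]|/andP[/eqP-> ->]]; rewrite zA.
by apply/eqP; rewrite cards_eq0; apply/eqP/setP => w; rewrite !inE; bcases.
Qed.

(** [y] does not see [x], hence at most [s] of its neighbours are in [S]; the remaining ones are in
    [Q]. *)
Lemma core_y_nbr : s < dg e V y -> exists2 t0, t0 \in Q & e y t0.
Proof.
move=> dy; apply/dg_gt0P.
have : dg e V y <= dg e (S :\ x) y + dg e Q y.
  apply: dg_cover => w wV eyw; have := core_nbr_y wV eyw.
  rewrite in_setU in_setD1; case: (eqVneq w x) => // wx.
  by have := nxy; rewrite se -wx eyw.
have := dg_card e (S :\ x) y; rewrite (card_D1 xS cS).
by move: dy; clear; lia.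
Qed.

Lemma core_k_gt t0 : t0 \in Q -> e y t0 -> s.+1 < k.
Proof.
move=> t0Q eyt0; have [xV yV _ _ _] := R.
have t0y : t0 != y by apply: contraTneq t0Q => ->; apply: y_common.
have tl : upath e [set t0; y] t0 y 1 by apply: upath1; rewrite ?set21 ?set22 // se.
apply: (core_k_large t0Q tl); first by rewrite subUset !sub1set (subsetP (common_sub S)).
move=> w; rewrite in_set2 => /orP[/eqP->//|/eqP->].
by rewrite in_setU (negbTE yS) (negbTE (y_common S)).
Qed.

(** Counts the neighbours that the exit keeps off the core: [s + 1] stands for [S] and the final 1
    for [y]. With [k >= s + 2] there is at least one of them, and at least two when
    [#|Q| = s + 1]. *)
Lemma dg_exit t0 : t0 \in Q -> e y t0 ->
  2 * k <= dg e (V :\: (y |: (S :|: Q))) t0 + s.+1 + dg e (Q :\ t0) t0 + 1.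
Proof.
move=> t0Q eyt0.
have t0V := subsetP (common_sub S) _ t0Q.
have t0y : t0 != y by apply: contraTneq t0Q => ->; apply: y_common.
have t0x : t0 != x by apply: contraTneq t0Q => ->; apply: core_notin.
have := degV t0V t0x t0y.
have : dg e V t0 <= dg e (V :\: (y |: (S :|: Q))) t0 + dg e (y |: (S :|: Q :\ t0)) t0.
  apply: dg_cover => w wV e0w; rewrite in_setD wV andbT !in_setU1 !in_setU in_setD1.
  have -> : w != t0 by apply: contraTneq e0w => ->; rewrite ie.
  by rewrite orNb.
have : dg e (y |: (S :|: Q :\ t0)) t0 <= dg e [set y] t0 + dg e (S :|: Q :\ t0) t0.
  by apply: dg_cover => w; rewrite in_setU.
have : dg e (S :|: Q :\ t0) t0 <= dg e S t0 + dg e (Q :\ t0) t0.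
  by apply: dg_cover => w; rewrite in_setU.
have := dg_set1 e t0 y; have := dg_card e S t0; rewrite cS; clear; lia.
Qed.

(** Here [Q :\ t0] still has [s + 1] vertices, so all head lengths survive with [Z] empty. *)
Lemma exit_wide t0 : t0 \in Q -> e y t0 -> s.+1 < #|Q| -> no_obstruction t0 set0 -> False.
Proof.
move=> t0Q eyt0 cQ2 nobs; have sk := core_k_gt t0Q eyt0.
have t0V := subsetP (common_sub S) _ t0Q.
have t0y : t0 != y by apply: contraTneq t0Q => ->; apply: y_common.
have t0S : t0 \notin S by apply/negP => /core_notin; rewrite t0Q.
have /dg_gt0P[u0] : 0 < dg e (V :\: (y |: (S :|: Q))) t0.
  have := dg_exit t0Q eyt0; have := dg_common t0V t0y t0S.
  have := dg_sub e t0 (subD1set Q t0); move: sk; clear; lia.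
rewrite in_setD in_setU1 negb_or => /andP[/andP[u0y u0SQ] u0V] e0.
apply: (@exit_core t0 u0 set0 s.+1) => //.
- exact: sub0set.
- by rewrite disjoint_sym -setI_eq0 setI0.
- by rewrite in_set0.
- exact: ltnW.
- move=> q i qQ is_; rewrite setU0; apply: heads_T => //.
  + by move=> a b aS /setD1P[_ bQ]; apply: (bip_common aS).
  + by rewrite cS.
  + by apply: leq_trans is_ _; move: cQ2; rewrite (cardsD1 t0) t0Q.
- by rewrite in_set0.
move=> v vV; rewrite in_setU => /norP[vS vQ] _ vy.
have := dg_core vV vy vQ; have := dg_common vV vy vS.
have := dg_sub e v (subD1set Q t0); have := dg_card e set0 v; rewrite cards0.
by case: (posnP (dg e (Q :\ t0) v)) => [->|_]; clear; lia.
Qed.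

(** [Z] is treated like [S :\ x], being reached with the same even lengths. Its single vertex turns
    the bound [s] on neighbours in [S] into the [s + 1] allowed by [no_bad]. *)
Lemma obstruction_high t0 Z : 1 < s -> t0 \in Q -> Z \subset V -> #|Z| <= 1 ->
  (forall q i, q \in Z -> i < s -> upath e (S :|: Q :\ t0 :|: Z) x q (2 + 2 * i)) ->
  no_obstruction t0 Z.
Proof.
move=> s1 t0Q ZV cZ headsZ K w m KV K0 xK yK dK wV wK wA wy bK hK tail.
have sQ1 : s <= #|Q :\ t0| by move: cQ; rewrite -/Q (cardsD1 t0) t0Q.
have [t tS tx] : exists2 t, t \in S & t != x by apply: card_gt1_D1; rewrite ?cS // ltnW.
have SxZ : x |: (S :\ x :|: Z) = S :|: Z by rewrite setUA setD1K.
have AV : S :|: Q :\ t0 :|: Z \subset V.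
  rewrite !subUset SV ZV andbT /=; apply: subset_trans (subD1set _ _) (common_sub S).
have AA : S :|: Q :\ t0 :|: Z \subset S :|: Q :|: Z.
  by apply: setSU; apply: setUS; apply: subD1set.
apply: (@no_bad K (S :|: Q :\ t0 :|: Z) (V :\: (K :|: (S :|: Q :\ t0 :|: Z)))
  (S :\ x :|: Z) w t s m s1 KV xK yK K0 AV) => //.
- exact: subsetDl.
- exact: disjointWl AA dK.
- by rewrite !in_setU xS.
- by apply: setSU; apply: subset_trans (subD1set _ _) (subsetUl _ _).
- by rewrite SxZ.
- by move=> L LK L0; rewrite SxZ; apply: hK.
- move=> q i; rewrite in_setU => /orP[/setD1P[qx qS]|qZ] is_; last exact: headsZ.
  by apply: upath_sub (core_heads_S (subD1set Q t0) sQ1 qS qx is_); apply: subsetUl.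
- move=> v vK.
  have vSQ : v \notin S :|: Q.
    apply/negP => vSQ; have := disjointFr dK (_ : v \in _ :|: Z).
    by rewrite in_setU vSQ vK => /(_ isT).
  have vy : v != y by apply: contraNneq yK => <-.
  have vQ : v \notin Q by move: vSQ; rewrite in_setU => /norP[].
  have := dg_core (subsetP KV _ vK) vy vQ; have := dg_D1 v xS.
  have : dg e (S :\ x :|: Z) v <= dg e (S :\ x) v + dg e Z v.
    by apply: dg_cover => u; rewrite in_setU.
  have := dg_card e Z v; move: cZ; clear; lia.
- by move=> v; rewrite in_setD in_setU negb_or => /andP[/andP[vK vA] _]; rewrite in_setU (negbTE vK) (negbTE vA).
- by rewrite !in_setU tS.
Qed.

Lemma core_high : 1 < s -> s < dg e V y -> False.
Proof.
move=> s1 dy; have [t0 t0Q eyt0] := core_y_nbr dy.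
have sk := core_k_gt t0Q eyt0.
case: (ltnP s.+1 #|Q|) => cQ2.
  apply: (exit_wide t0Q eyt0 cQ2); apply: obstruction_high; rewrite ?sub0set ?cards0 //.
  by move=> q i; rewrite in_set0.
have cQ1 : #|Q :\ t0| = s.
  by apply: card_D1 => //; apply/eqP; rewrite eqn_leq cQ2.
have bQ1 : bip e S (Q :\ t0) by move=> a b aS /setD1P[_ bQ]; apply: (bip_common aS).
have heads q i : q \in Q :\ t0 -> i < s -> upath e (S :|: Q :\ t0) x q (1 + 2 * i).
  by move=> qQ is_; apply: heads_T; rewrite ?cQ1 ?cS // ltnW.
(* Two neighbours are wanted because one of them may turn out to be the vertex placed in [Z]. *)
have /dg_gt1P[b [c [bW cW cb e0b e0c]]] : 1 < dg e (V :\: (y |: (S :|: Q))) t0.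
  have := dg_exit t0Q eyt0; have := dg_card e (Q :\ t0) t0; rewrite cQ1.
  by move: sk; clear; lia.
(* Such a vertex would lose [2 * s - 1] neighbours, one more than [s] heads pay for. Placed in [Z]
   it provides the length [1 + 2 * s], and the budget rises to [2 * s]; if there is none, [s] heads
   suffice. *)
pose bad v := [&& v \in V, v != y, v \notin S :|: Q, s <= dg e S v & Q :\ t0 \subset [set u | e v u]].
case: (boolP [exists v, bad v]) => [/existsP[v /and5P[vV vy vSQ dv Qv]]|nobad].
  have [u0 u0W [e0 u0v]] : exists2 u0, u0 \in V :\: (y |: (S :|: Q)) & e t0 u0 /\ u0 != v.
    case: (eqVneq b v) => [bv|]; last by exists b.
    by exists c => //; rewrite -bv.
  move: u0W; rewrite in_setD in_setU1 negb_or => /andP[/andP[u0y u0SQ] u0V].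
  have vQ q : q \in Q :\ t0 -> e v q by move/(subsetP Qv); rewrite inE.
  have vSQ1 : v \notin S :|: Q :\ t0.
    by apply: contra vSQ; apply/subsetP; apply: setUS; apply: subD1set.
  apply: (@exit_core t0 u0 [set v] s.+1) => //.
  - by rewrite sub1set.
  - by rewrite disjoints1.
  - by rewrite in_set1 eq_sym.
  - exact: ltnW.
  - move=> q i qQ; rewrite ltnS leq_eqVlt => /orP[/eqP->|is_].
      have H : upath e (v |: (S :|: Q :\ t0)) x q (1 + 2 * s).
        apply: heads_extra => //.
        by move=> a a' /set1P->; apply: vQ.
      by rewrite setUC.
    by apply: upath_sub (heads q i qQ is_); apply: subsetUl.
  - by rewrite in_set1.
  - move=> u uV; rewrite in_setU => /norP[uS uQ] _ uy.
    have := dg_core uV uy uQ; have := dg_card e (Q :\ t0) u; rewrite cQ1.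
    have := dg_set1 e u v; move: s1.
    by case: (posnP (dg e (Q :\ t0) u)) => [->|_]; clear; lia.
  - have obs : no_obstruction t0 [set v].
      apply: obstruction_high; rewrite ?sub1set ?cards1 // => q i /set1P-> is_.
      have [t tQ] : exists t, t \in Q :\ t0.
        by apply/set0Pn; rewrite -card_gt0 cQ1 ltnW.
      have H : upath e (v |: (S :|: Q :\ t0)) x v (2 + 2 * i).
        apply: (heads_S se ie bQ1 (t := t)) => //; rewrite ?cQ1 ?cS //.
          by rewrite se vQ.
        exact: ltnW.
      by rewrite setUC.
    exact: obs.
move: bW; rewrite in_setD in_setU1 negb_or => /andP[/andP[b_y bSQ] bV].
apply: (@exit_core t0 b set0 s) => //.
- exact: sub0set.
- by rewrite disjoint_sym -setI_eq0 setI0.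
- by rewrite in_set0.
- exact: ltnW.
- by rewrite ltnW // ltnW.
- by move=> q i qQ is_; rewrite setU0; apply: heads.
- by rewrite in_set0.
- move=> v vV vSQ _ vy; have vSQ' := vSQ.
  move: vSQ'; rewrite in_setU => /norP[vS vQ].
  have dv := dg_core vV vy vQ.
  have := dg_card e set0 v; rewrite cards0 => d0.
  have := dg_card e (Q :\ t0) v; rewrite cQ1 => dQ.
  have : ~~ ((dg e S v == s) && (dg e (Q :\ t0) v == s)).
    apply: contra nobad => /andP[/eqP ds /eqP dq]; apply/existsP; exists v.
    apply/and5P; split; rewrite ?ds //.
    have /eqP E : [set u in Q :\ t0 | e v u] == Q :\ t0.
      by rewrite eqEcard cQ1 -[X in X <= _]dq leqnn andbT; apply/subsetP => u; rewrite inE => /andP[].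
    by rewrite -E; apply/subsetP => u; rewrite !inE => /andP[].
  move: s1 dv d0 dQ.
  by case: (posnP (dg e (Q :\ t0) v)) => [->|_]; clear; lia.
- have obs : no_obstruction t0 set0.
    apply: obstruction_high; rewrite ?sub0set ?cards0 //.
    by move=> q i; rewrite in_set0.
  exact: obs.
Qed.

(** An obstruction is attached to [x], [a] and [w] only. Since [k > s + 1 = 2], this 3-separation is
    excluded, with a vertex of [Q :\ t0] as the additional vertex outside. *)
Lemma core_one_wide : s = 1 -> 2 < #|Q| -> 1 < dg e V y -> False.
Proof.
move=> s1 cQ3 dy; have [t0 t0Q eyt0] : exists2 t0, t0 \in Q & e y t0.
  by apply: core_y_nbr; rewrite s1.
have sk := core_k_gt t0Q eyt0; rewrite s1 in sk.
apply: (exit_wide t0Q eyt0); first by rewrite s1.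
move=> K w m KV K0 xK yK; rewrite !setU0 => dK wV wK wA wy bK _ tail.
have [a aS ax] : exists2 a, a \in S & a != x by apply: card_gt1_D1; rewrite ?cS ?s1.
have Sxa : S = [set x; a].
  apply/eqP; rewrite eq_sym eqEcard subUset !sub1set xS aS cS s1 cards2.
  by rewrite eq_sym ax.
have [t tQ tt0] : exists2 t, t \in Q & t != t0 by apply: card_gt1_D1 => //; apply: ltnW.
have dKv v : v \in S :|: Q -> v \notin K by move=> vSQ; rewrite (disjointFr dK vSQ).
have tS : t \notin S by apply/negP => /core_notin; rewrite tQ.
have tA : t \in S :|: Q :\ t0 by rewrite in_setU in_setD1 tt0 tQ orbT.
have wS v : v \in S :|: Q :\ t0 -> v != w by move=> vA; apply: contraNneq wA => <-.
have aA : a \in S :|: Q :\ t0 by rewrite in_setU aS.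
apply: (@no_three_sep K a w t m) => //.
- exact: subsetP SV _ aS.
- by rewrite dKv // in_setU aS.
- by apply: contraNneq yS => <-.
- by rewrite eq_sym wS // in_setU xS.
- exact: wS.
- exact: subsetP (common_sub S) _ tQ.
- by rewrite dKv // in_setU tQ orbT.
- by apply: contraNneq tS => ->.
- by apply: contraNneq tS => ->.
- exact: wS.
- by apply: contraTneq tQ => ->; apply: y_common.
- by move: bK; rewrite Sxa setUC.
apply: upath_sub tail; apply: setDS; rewrite -Sxa; apply: setUS; exact: subsetUl.
Qed.

End Core.

(** With a single neighbour [r] of [y], the pair [{x, r}] would separate all other vertices from
    [y]. *)
Lemma dg_y_gt1 : 1 < dg e V y.
Proof.
have [xV yV xy V0 _] := R; rewrite ltnNge; apply/negP => dy.
have [r hr] : exists r, forall w, w \in V -> e y w -> w = r.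
  case: (posnP (dg e V y)) => [d0|/dg_gt0P[r rV eyr]].
    exists x => w wV eyw; have : 0 < dg e V y by apply/dg_gt0P; exists w.
    by rewrite d0.
  exists r => w wV eyw; apply/eqP; apply: contraT => wr.
  suff : 1 < dg e V y by rewrite ltnNge dy.
  rewrite /dg (cardsD1 r) inE rV eyr (cardsD1 w) in_setD1 inE wr wV eyw.
  by rewrite addnA.
case/set0Pn: V0 => v; rewrite !inE negb_or => /andP[/andP[vx vy] vV].
pose K := V :\: [set x; y; r].
apply: (no_two_sep (K := K) (z1 := x) (z2 := r) (t := y)) => //.
- exact: subsetDl.
- by rewrite !inE eqxx.
- by rewrite !inE eqxx !orbT.
- suff /dg_gt0P[w wK _] : 0 < dg e K v by apply/set0Pn; exists w.
  have := degV vV vx vy.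
  have : dg e V v <= dg e K v + dg e [set x; y; r] v.
    by apply: dg_cover => w wV _; rewrite in_setD wV andbT orNb.
  have := dg_card e [set x; y; r] v.
  have : #|[set x; y; r]| <= 3.
    by rewrite setUC cardsU1 cards2; case: (_ \notin _); case: (_ != _).
  move: k_gt1; clear; lia.
- by rewrite !inE eqxx !orbT.
- by rewrite eq_sym.
- apply/negP => /eqP yr.
  have : border e V (V :\: [set x; y]) [set x].
    move=> a b; rewrite !inE negb_or => /andP[/andP[ax ay] aV] bV eab.
    rewrite bV; case: (eqVneq b x) => //= bx; rewrite !orbF andbT.
    apply: contraNneq ay => bY; rewrite bY se in eab.
    by rewrite (hr a aV eab) -yr.
  apply: no_one_sep; rewrite ?subsetDl // ?inE ?eqxx ?orbT //.
  by apply/set0Pn; exists v; rewrite !inE negb_or vx vy.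
move=> a b; rewrite !inE !negb_or => /andP[/andP[/andP[ax ay] ar] aV] bV eab.
rewrite bV andbT; case: (eqVneq b y) => [bY|]; last by bcases.
by rewrite bY se in eab; rewrite (hr a aV eab) eqxx in ar.
Qed.

(* Leaving through [r], the star at [x] without [r] is contracted; no vertex but [r]
   has two neighbours in it, so that no degree decreases. *)
Lemma exit_low r : let N := common [set x] in
  r \in V -> e y r -> (forall w, w \in V -> e y w -> w = r \/ w \in N) ->
  (forall v, v \in V -> v != x -> v != y -> v != r -> dg e (N :\ r) v <= 1) ->
  dg e N r < (2 * k).-2 -> False.
Proof.
move=> N rV eyr hN hsmall dr; have [xV yV xy _ _] := R.
have rx : r != x by apply: contraNneq nxy => <-; rewrite se.
have ry : r != y by apply: contraTneq eyr => ->; rewrite ie.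
have NP w : (w \in N) = [&& w \in V, w != y & e x w].
  apply/commonP/and3P => -[wV wy H]; split=> //; first by apply: H; rewrite in_set1.
  by move=> a /set1P->.
have xN : x \notin N by rewrite NP ie !andbF.
have yN : y \notin N by rewrite NP eqxx !andbF.
have NV : N \subset V := common_sub _.
pose A := x |: N :\ r; pose W := V :\: (y |: (r |: A)).
(* Of the [2 * k] neighbours of [r], at most two are [x] and [y], and fewer than [2 * k - 2] lie in
   [N]. *)
have [u0 u0W eru0] : exists2 u0, u0 \in W & e r u0.
  apply/dg_gt0P; have := degV rV rx ry.
  have : dg e V r <= dg e W r + dg e (x |: (y |: N)) r.
    apply: dg_cover => w wV erw; rewrite in_setD wV andbT !in_setU1 in_setD1.
    have /negbTE-> : w != r by apply: contraTneq erw => ->; rewrite ie.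
    by bcases.
  have : dg e (x |: (y |: N)) r <= dg e [set x] r + dg e (y |: N) r.
    by apply: dg_cover => w; rewrite in_setU1 in_set1.
  have : dg e (y |: N) r <= dg e [set y] r + dg e N r.
    by apply: dg_cover => w; rewrite in_setU1 in_set1.
  have := dg_set1 e r x; have := dg_set1 e r y; move: dr k_gt1; clear; lia.
pose D := component e W u0; pose C := r |: D.
have DW : D \subset W := component_sub _ _ _.
have u0D : u0 \in D by apply: component_refl.
have WV : W \subset V := subsetDl _ _.
have DV := subset_trans DW WV.
have Dn v : v \in D -> [/\ v != x, v != y, v != r & v \notin N].
  move/(subsetP DW); rewrite in_setD !in_setU1 in_setD1 !negb_or negb_and negbK.
  by case/andP=> /and4P[vy vr vx]; rewrite (negbTE vr).
have CV : C \subset V by rewrite subUset sub1set rV.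
have rD : r \notin D by apply/negP => /Dn[_ _]; rewrite eqxx.
have xC : x \notin C.
  by rewrite in_setU1 negb_or eq_sym rx; apply/negP => /Dn[]; rewrite eqxx.
have yC : y \notin C.
  by rewrite in_setU1 negb_or eq_sym ry; apply/negP => /Dn[_]; rewrite eqxx.
have bD v w : v \in D -> w \in V -> e v w -> (w \in C) || (w \in N :\ r).
  move=> vD wV evw; have [vx vy vr vN] := Dn v vD; have vV := subsetP DV _ vD.
  case: (boolP (w \in W)) => wW.
    by have := component_closed vD wW evw; rewrite in_set0 orbF => wD; rewrite in_setU1 wD orbT.
  have : w \in y |: (r |: A) by apply: contraR wW => wA; apply/setDP.
  rewrite !in_setU1 => /or4P[/eqP E|->|/eqP E|->]; rewrite ?orbT //.
    rewrite E se in evw; case: (hN v vV evw) => [E'|]; last by rewrite (negbTE vN).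
    by rewrite E' eqxx in vr.
  by case/negP: vN; rewrite NP vV vy se -E.
have rC : rconn e C r.
  move=> L LC rL bL.
  have LD : L \subset D.
    apply/subsetP => v vL; have := subsetP LC _ vL; rewrite in_setU1.
    by case/orP=> // /eqP vz; rewrite -vz vL in rL.
  case: (boolP (u0 \in L)) => u0L.
    have := bL _ r u0L; rewrite se eru0 (negbTE rL) in_set0 setU11.
    by move/(_ isT isT).
  apply: (component_rconn se u0W LD u0L) => v w vL wD evw.
  by apply: bL evw => //; rewrite in_setU1 wD orbT.
apply: ng.
apply: (@contract _ e V x y k C A (N :\ r) [set r; y] 1 1 k r 1 se ie IH) => //.
- by rewrite subUset sub1set xV; apply: subset_trans (subD1set _ _) NV.
- by rewrite subUset !sub1set rV.
- rewrite disjoint_subset; apply/subsetP => v; rewrite in_setU1 in_setD1.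
  case/predU1P=> [->//|/andP[vr vN]]; rewrite inE in_setU1 (negbTE vr) /=.
  by apply/negP => /Dn[_ _ _]; rewrite vN.
- exact: setU11.
- exact: subsetUr.
- exact: setU11.
- have : x |: (y |: C) \subset V.
    by rewrite subUset sub1set xV subUset sub1set yV.
  move/subset_leq_card; apply: leq_trans.
  by rewrite !cardsU1 in_setU1 negb_or xy yC xC.
- apply/set0Pn; exists u0; rewrite in_setD1 in_setU1 u0D orbT andbT.
  by apply: contraNneq rD => <-.
- move=> q [|i] // qN _; have /setD1P[_ qN'] := qN.
  apply: upath1; rewrite ?setU11 //.
  + by rewrite in_setU1 qN orbT.
  + by apply: contraNneq xN => ->.
  + by move: qN'; rewrite NP => /and3P[].
- by apply: upath1; rewrite ?set21 ?set22 // se.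
- move=> w; rewrite in_set2 => /orP[/eqP->//|/eqP->].
  by rewrite in_setU (negbTE yC) orbF in_setU1 in_setD1 (negbTE yN) andbF eq_sym (negbTE xy).
(* Vertices of [D] see nothing outside [C] and [N :\ r], so a bad set would already have a single
   attachment in the original graph. *)
- move=> K z KC rK K0 zC bK.
  apply: (no_one_sep (K := K) (z := z)) => //.
  + exact: subset_trans KC CV.
  + by apply: contra xC => /(subsetP KC).
  + by apply: contra yC => /(subsetP KC).
  move=> v w vK wV evw; apply: (bK v w) => //; rewrite in_setU.
  apply: (bD v) => //; have := subsetP KC _ vK; rewrite in_setU1 => /predU1P[vr|//].
  by rewrite -vr vK in rK.
- move=> v vC vr; right.
  have vD : v \in D by move: vC; rewrite in_setU1 (negbTE vr).
  have [vx vy _ _] := Dn v vD; have vV := subsetP DV _ vD.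
  have := degV vV vx vy; have := hsmall v vV vx vy vr.
  have : dg e V v <= dg e C v + dg e (N :\ r) v by apply: dg_cover => w; apply: bD.
  by case: (dg e (N :\ r) v) => [|[]] //; clear; lia.
- exact: ltnW.
Qed.

Lemma core_absurd s S Q : maximal_core s -> s < dg e V y ->
  x \in S -> S \subset V -> y \notin S -> #|S| = s.+1 ->
  Q \subset V -> y \notin Q -> bip e S Q -> s < #|Q| -> False.
Proof.
move=> smax dy xS SV yS cS QV yQ bSQ sQ; have [xV yV xy _ _] := R.
have cQ : s < #|common S|.
  apply: leq_trans sQ _; apply: subset_leq_card; apply/subsetP => q qQ.
  apply/commonP; split; [exact: subsetP qQ | by apply: contraNneq yQ => <- |].
  by move=> a aS; apply: bSQ.
have nbr := core_nbr_y xS SV yS cS cQ smax.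
have dy1 := dg_y_gt1.
case: (ltngtP s 1) => s1; last first.
- rewrite s1 in cS cQ smax.
  (* Every [v] sharing two neighbours with [x] yields a core of its own with [s = 1], to which the
     results on cores apply as well. *)
  have narrow v : v \in V -> v != x -> v != y -> 1 < #|common [set x; v]| ->
      #|common [set x; v]| <= 2 /\
      (forall w, w \in V -> e y w -> w \in [set x; v] :|: common [set x; v]).
    move=> vV vx vy cv.
    have xv : x \in [set x; v] by rewrite set21.
    have xvV : [set x; v] \subset V by rewrite subUset !sub1set xV.
    have yxv : y \notin [set x; v] by rewrite !inE negb_or !(eq_sym y) xy vy.
    have cxv : #|[set x; v]| = 2 by rewrite cards2 eq_sym vx.
    split; last exact: (core_nbr_y xv xvV yxv cxv cv smax).
    rewrite leqNgt; apply/negP => c3.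
    exact: (core_one_wide xv xvV yxv cxv cv smax erefl c3 dy1).
  have NE v q : q \in common [set x] -> e v q -> q \in common [set x; v].
    case/commonP=> qV qy H evq; apply/commonP; split=> // a.
    by rewrite in_set2 => /orP[]/eqP-> //; apply: H; rewrite in_set1.
  (* Two neighbours of [v] in the star without [r] make [{x, v}] a core. That core must contain [r],
     a neighbour of [y], so [r] would be a third common neighbour. *)
  have hsmall r v : r \in V -> e y r -> v \in V -> v != x -> v != y -> v != r ->
      dg e (common [set x] :\ r) v <= 1.
    move=> rV eyr vV vx vy vr; rewrite leqNgt; apply/negP => H.
    have sub : [set u in common [set x] :\ r | e v u] \subset common [set x; v] :\ r.
      apply/subsetP => u; rewrite inE => /andP[/setD1P[ur uN] evu].
      by rewrite in_setD1 ur NE.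
    have c1 : 1 < #|common [set x; v] :\ r| := leq_trans H (subset_leq_card sub).
    have cv : 1 < #|common [set x; v]|.
      by apply: leq_trans c1 _; apply: subset_leq_card; apply: subD1set.
    have [c2 nb] := narrow v vV vx vy cv.
    have := nb r rV eyr; rewrite in_setU in_set2 eq_sym.
    have -> : x == r = false by apply: contraNF nxy => /eqP->; rewrite se.
    rewrite eq_sym (negbTE vr) /= => rC.
    by move: c2; rewrite (cardsD1 r) rC ltnNge; case/negP; rewrite -ltnS ltnS.
  have [a aS ax] : exists2 a, a \in S & a != x by apply: card_gt1_D1; rewrite ?cS.
  have Sxa : S = [set x; a].
    apply/eqP; rewrite eq_sym eqEcard subUset !sub1set xS aS cS cards2.
    by rewrite eq_sym ax.
  have [t0 t0C eyt0] := core_y_nbr xS SV yS cS cQ smax dy1.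
  have k2 := core_k_gt xS SV yS cS cQ t0C eyt0.
  have CN : common S \subset common [set x].
    apply/subsetP => q /commonP[qV qy H]; apply/commonP; split=> // u /set1P->.
    exact: H.
  (* Only [a] can be a neighbour of [y] outside the star; in that case it is the exit, otherwise any
     neighbour of [y] will do. *)
  have [r [rV eyr hN]] : exists r, [/\ r \in V, e y r &
      forall w, w \in V -> e y w -> w = r \/ w \in common [set x]].
    have cases w : w \in V -> e y w -> w = a \/ w \in common [set x].
      move=> wV eyw; have := nbr w wV eyw; rewrite Sxa in_setU in_set2 -Sxa.
      case/orP=> [/orP[/eqP wx|/eqP->]|/(subsetP CN)]; [|by left|by right].
      by have := nxy; rewrite se -wx eyw.
    have [b bV eyb] : exists2 b, b \in V & e y b by apply/dg_gt0P; apply: ltnW.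
    case: (boolP (e y a && (a \notin common [set x]))) => [/andP[eya aN]|H].
      by exists a; split=> //; apply: subsetP SV _ aS.
    exists b; split=> // w wV eyw; right; case: (cases w wV eyw) => // wa.
    by rewrite wa in eyw *; move: H; rewrite eyw /= negbK.
  apply: (exit_low rV eyr hN (fun v => hsmall r v rV eyr)).
  have [b [c [bV cV cb eyb eyc]]] := dg_gt1P dy1.
  (* The bound for the star without a second neighbour [r'] of [y] shows that [r] has at most two
     neighbours in the star, fewer than [2 * k - 2] as [k > 2]. *)
  have [r' [r'V eyr' rr']] : exists r', [/\ r' \in V, e y r' & r != r'].
    case: (eqVneq r b) => [rb|]; last by exists b.
    by exists c; rewrite rb eq_sym.
  have rx : r != x by apply: contraNneq nxy => <-; rewrite se.
  have ry : r != y by apply: contraTneq eyr => ->; rewrite ie.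
  have := hsmall r' r r'V eyr' rV rx ry rr'.
  have : dg e (common [set x]) r <= dg e (common [set x] :\ r') r + dg e [set r'] r.
    by apply: dg_cover => w wN _; rewrite in_setD1 in_set1 wN andbT orNb.
  have := dg_set1 e r r'; move: k2; clear; lia.
- exact: (core_high xS SV yS cS cQ smax s1 dy).
have s0 : s = 0 by case: s s1 {smax dy cS sQ cQ}.
have Sx : S = [set x].
  by apply/eqP; rewrite eq_sym eqEcard sub1set xS cards1 cS s0.
have [r rV eyr] : exists2 r, r \in V & e y r by apply/dg_gt0P; apply: ltnW.
have ncom v : v \in V -> v != x -> v != y -> dg e (common [set x]) v <= 1.
  move=> vV vx vy; have := dg_common xS SV yS cS smax vV vy.
  by rewrite Sx in_set1 s0; apply.
apply: (exit_low rV eyr).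
- move=> w wV eyw; right; have := nbr w wV eyw; rewrite Sx in_setU in_set1.
  by case/orP=> // /eqP wx; have := nxy; rewrite se -wx eyw.
- move=> v vV vx vy _; apply: leq_trans (ncom v vV vx vy).
  by apply: dg_sub; apply: subD1set.
have rx : r != x by apply: contraNneq nxy => <-; rewrite se.
have ry : r != y by apply: contraTneq eyr => ->; rewrite ie.
by have := ncom r rV rx ry; move: k_gt1; clear; lia.
Qed.
End Counterexample.

(** * Choice of the end, deletion of the edge [xy], and translation of the block definition *)

Section Main.
Variable T : finType.
Implicit Types (e : rel T) (A B K L V Q S : {set T}) (a b u v w x y z t : T).

Lemma rooted_sym e V x y : rooted e V x y -> rooted e V y x.
Proof.
move=> [xV yV xy V0 H]; split=> //; [by rewrite eq_sym | by rewrite setUC |].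
by move=> K z; rewrite setUC; apply: H.
Qed.

Lemma min_deg_sym e V x y k : min_deg e V x y k -> min_deg e V y x k.
Proof. by move=> H v vV vx vy; apply: H. Qed.

(** [s < dg e V x] holds because [Q] consists of neighbours of [x]. Applied at both ends, it bounds
    the smaller of the two values by the degree of the opposite end. *)
Lemma max_core_exists e V x y : x \in V -> x != y -> ~~ e x y -> 0 < dg e V x ->
  exists s S Q, [/\ maximal_core e V x y s, s < dg e V x, x \in S, S \subset V &
    [/\ y \notin S, #|S| = s.+1, Q \subset V, y \notin Q & bip e S Q /\ s < #|Q| ] ].
Proof.
move=> xV xy nxy dx.
pose P s := [exists S : {set T}, [exists Q : {set T},
  [&& x \in S, S \subset V, y \notin S, #|S| == s.+1,
      Q \subset V, y \notin Q, s < #|Q| & [forall a in S, [forall b in Q, e a b]]]]].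
have PP s S Q : x \in S -> S \subset V -> y \notin S -> #|S| = s.+1 ->
    Q \subset V -> y \notin Q -> s < #|Q| -> bip e S Q -> P s.
  move=> xS SV yS cS QV yQ cQ bSQ; apply/existsP; exists S; apply/existsP; exists Q.
  rewrite xS SV yS cS eqxx QV yQ cQ /=; apply/forallP => a; apply/implyP => aS.
  by apply/forallP => b; apply/implyP; apply: bSQ.
have P0 : exists s, P s.
  exists 0; apply: (PP 0 [set x] [set u in V | e x u]) => //.
  - by rewrite in_set1.
  - by rewrite sub1set.
  - by rewrite in_set1 eq_sym.
  - by rewrite cards1.
  - by apply/subsetP => u; rewrite inE => /andP[].
  - by rewrite inE (negbTE nxy) andbF.
  - by move=> a b /set1P->; rewrite inE => /andP[].
have Pb s : P s -> s <= #|T|.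
  case/existsP => S /existsP[Q /and5P[_ _ _ _ /and4P[_ _ sQ _]]].
  exact: leq_trans (ltnW sQ) (max_card _).
case: (ex_maxnP P0 Pb) => s /existsP[S /existsP[Q]].
case/and5P=> xS SV yS /eqP cS /and4P[QV yQ sQ /forallP bSQ] smax.
have bip_SQ : bip e S Q.
  by move=> a b aS bQ; move/implyP/(_ aS)/forallP/(_ b)/implyP: (bSQ a); apply.
exists s, S, Q; split=> //.
  move=> S' Q' xS' S'V yS' Q'V yQ' b' cS'; rewrite ltnNge; apply/negP => cQ'.
  by have := smax s.+1 (PP _ _ _ xS' S'V yS' cS' Q'V yQ' cQ' b'); rewrite ltnn.
apply: leq_trans sQ _; apply: subset_leq_card; apply/subsetP => q qQ.
by rewrite inE (subsetP QV) //= bip_SQ.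
Qed.

Lemma nonadjacent_paths2 e V x y k : symmetric e -> irreflexive e -> theorem_below T #|V| ->
  rooted e V x y -> min_deg e V x y k -> ~~ e x y -> 1 < k -> paths2 e V x y k.
Proof.
move=> se ie IH R dg0 nxy k1; apply: NNPP => ng.
have [xV yV xy _ _] := R.
have ng' : ~ paths2 e V y x k by move/(paths2_sym se).
have nyx : ~~ e y x by rewrite se.
have yx : y != x by rewrite eq_sym.
have R' := rooted_sym R; have dg' := min_deg_sym dg0.
have dy := dg_y_gt1 se ie IH R dg0 k1 ng.
have dx := dg_y_gt1 se ie IH R' dg' k1 ng'.
have [s [S [Q [smax sdx xS SV [yS cS QV yQ [bSQ sQ]]]]]] :=
  max_core_exists xV xy nxy (ltnW dx).
have [s' [S' [Q' [smax' sdx' xS' SV' [yS' cS' QV' yQ' [bSQ' sQ']]]]]] :=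
  max_core_exists yV yx nyx (ltnW dy).
case: (leqP s s') => ss'.
  exact: (core_absurd se ie IH R dg0 nxy k1 ng smax (leq_ltn_trans ss' sdx') xS SV yS cS QV yQ bSQ sQ).
exact: (core_absurd se ie IH R' dg' nyx k1 ng' smax' (ltn_trans ss' sdx)
   xS' SV' yS' cS' QV' yQ' bSQ' sQ').
Qed.

Lemma all_paths2 n : theorem_below T n.
Proof.
elim: n => [//|n IHn] e V x y k se ie cV R dg0.
case: (leqP k 1) => k1; first exact: paths2_le1.
have [xV yV xy V0 HR] := R.
(* The edge [xy] is deleted. Rootedness and the degree condition concern only vertices other than
   [x] and [y], so both persist. *)
pose e1 : rel T := fun u v => [&& e u v, ~~ ((u == x) && (v == y)) & ~~ ((u == y) && (v == x))].
have ee1 u v : u != x -> u != y -> e1 u v = e u v.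
  by move=> ux uy; rewrite /e1 (negbTE ux) (negbTE uy) !andbT.
apply: (@paths2_sub _ e1); first by move=> u v /andP[].
apply: nonadjacent_paths2 => //.
- by move=> u v; rewrite /e1 se (andbC (u == x)) (andbC (u == y)) (andbC (~~ _)).
- by move=> u; rewrite /e1 ie.
- move=> e' V' x' y' k' se' ie' cV'; apply: IHn => //.
  exact: leq_trans cV' _.
- split=> // K z KV K0 bK; apply: (HR K z KV K0) => u w uK wV euw.
  have := subsetP KV _ uK; rewrite !inE negb_or => /andP[/andP[ux uy] _].
  by have := bK u w uK wV; rewrite ee1 // !inE; apply.
- move=> v vV vx vy; case: (dg0 v vV vx vy) => H; [by left|right].
  apply: leq_trans H _; apply: subset_leq_card; apply/subsetP => u.
  by rewrite !inE ee1.
- by rewrite /e1 !eqxx andbF.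
Qed.

Lemma connect_border e A K u w : border e A K set0 -> u \in K ->
  connect (induced e A) u w -> w \in K.
Proof.
move=> bK uK /connectP[p ep ->]; elim: p u uK ep => //= v p IHp u uK.
case/andP=> /and3P[_ vA euv]; apply: IHp.
by have := bK _ _ uK vA euv; rewrite in_set0 orbF.
Qed.

(* A smallest set [K] violating [rooted] would form, together with its only
   neighbour [z], an end block without a suitable vertex. *)
Lemma two_connected_rootedP e x y : symmetric e -> two_connected_rooted e x y ->
  rooted e [set: T] x y.
Proof.
move=> se /and3P[xy /and3P[/andP[_ conn] cT _] /forallP R2].
have {}conn K u w : border e setT K set0 -> u \in K -> w \in K.
  move=> bK uK; apply: connect_border bK uK _.
  by move/forallP/(_ u): conn; rewrite in_setT => /forallP/(_ w); rewrite in_setT.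
split; rewrite ?in_setT //.
  rewrite -card_gt0 cardsD setTI cardsT cards2 xy; move: cT; clear; lia.
suff H n K z : #|K| < n -> x \notin K -> y \notin K -> K != set0 ->
    ~ border e setT K [set z].
  move=> K z KV K0; apply: (H #|K|.+1) => //.
    by apply/negP => /(subsetP KV); rewrite !inE eqxx.
  by apply/negP => /(subsetP KV); rewrite !inE eqxx orbT.
elim: n K z => // n IHn K z cK xK yK K0 bK.
have [c cinK] := set0Pn _ K0.
have small L v : L \proper K -> L != set0 -> ~ border e setT L [set v].
  move=> LK; apply: IHn.
  - exact: leq_trans (proper_card LK) _.
  - by apply: contra xK; apply: (subsetP (proper_sub LK)).
  - by apply: contra yK; apply: (subsetP (proper_sub LK)).
have zK : z \notin K.
  apply/negP => zK; case/negP: xK; apply: conn cinK => u w uK _ euw.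
  by case/orP: (bK u w uK (in_setT _) euw) => [->//|/set1P->]; rewrite zK.
pose B := z |: K.
have zB : z \in B := setU11 _ _.
have su A : connect_sym (induced e A).
  by apply: sym_connect_sym => a b; rewrite /induced /= se andbCA.
(* The vertices of [K] not joined to [z] inside [B] form a closed set that misses [x], against
   connectedness. *)
have toz u : u \in B -> connect (induced e B) u z.
  rewrite in_setU1 => /predU1P[->|uK]; first exact: connect0.
  apply: contraT => nuz.
  pose M := [set v in K | ~~ connect (induced e B) v z].
  have uM : u \in M by rewrite inE uK.
  have : x \in M.
    apply: conn uM => v w; rewrite inE => /andP[vK nv] _ evw; rewrite in_set0 orbF.
    have wB : w \in B by have := bK v w vK (in_setT _) evw; rewrite in_set1 in_setU1 orbC.
    have cvw : connect (induced e B) v w.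
      by apply: connect1; rewrite /induced /= wB evw in_setU1 vK orbT.
    have nw : ~~ connect (induced e B) w z by apply: contra nv; apply: connect_trans.
    rewrite inE nw andbT; move: wB; rewrite in_setU1 => /predU1P[wz|//].
    by rewrite wz connect0 in nw.
  by rewrite inE (negbTE xK).
(* A component of [A :\ v] avoiding [z] cannot leave [K]; it would be a proper subset of [K]
   attached to [v] alone, against the minimality of [K]. *)
have nocutK A v u : v \in K -> B \subset A ->
    (forall w, w \in A -> connect (induced e A) w z) -> u \in A :\ v ->
    connect (induced e (A :\ v)) u z.
  move=> vK BA cA uA; apply: contraT => nuz.
  pose M := component e (A :\ v) u.
  have zM : z \notin M by rewrite inE negb_and nuz orbT.
  have uM : u \in M by apply: component_refl.
  have MA : M \subset A :\ v := component_sub _ _ _.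
  have MK : M \subset K.
    rewrite -setD_eq0; apply: contraT => /set0Pn[w wM].
    suff : z \in M :\: K by rewrite in_setD (negbTE zM) andbF.
    have wA : w \in A by have := wM; rewrite in_setD => /andP[_ /(subsetP MA)/setD1P[]].
    apply: connect_border wM (cA w wA) => a b; rewrite !(in_setD _ K).
    case/andP=> aK aM bA eab; rewrite in_set0 orbF.
    have bnK : b \notin K.
      apply/negP => bK'; rewrite se in eab.
      case/orP: (bK b a bK' (in_setT _) eab) => [|/set1P az]; first by rewrite (negbTE aK).
      by rewrite -az aM in zM.
    have bv : b != v by apply: contraNneq bnK => ->.
    have bAv : b \in A :\ v by rewrite in_setD1 bv.
    by rewrite bnK; have := component_closed aM bAv eab; rewrite in_set0 orbF.
  exfalso; apply: (small M v).
  - rewrite properEneq MK andbT; apply: contraTneq vK => <-.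
    by apply/negP => /(subsetP MA)/setD1P[]; rewrite eqxx.
  - by apply/set0Pn; exists u.
  move=> a b aM _ eab; rewrite in_set1; case: (eqVneq b v) => [|bv]; first by rewrite orbT.
  have bAv : b \in A :\ v.
    rewrite in_setD1 bv (subsetP BA) //.
    have := bK a b (subsetP MK _ aM) (in_setT _) eab.
    by rewrite in_set1 in_setU1 orbC.
  by have := component_closed aM bAv eab; rewrite in_set0 orbF => ->.
have nocut A v : v \in K -> B \subset A ->
    (forall w, w \in A -> connect (induced e A) w z) -> ~~ cut_vertex e A v.
  move=> vK BA cA; apply/negP => /andP[_ /existsP[u /andP[uA /existsP[w /andP[wA]]]]].
  case/andP=> _ /negP; apply; apply: connect_trans (nocutK _ _ _ vK BA cA uA) _.
  by rewrite su; apply: nocutK.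
have leaveK A u w : z \notin A -> u \in K -> connect (induced e A) u w -> w \in K.
  move=> zA; apply: connect_border => a b aK bA eab.
  case/orP: (bK a b aK (in_setT _) eab) => [->//|/set1P bz].
  by rewrite -bz bA in zA.
have notinB w : w \notin B -> w != z /\ w \notin K.
  by rewrite in_setU1 negb_or => /andP[].
have cz_cut A w : B \subset A -> w \in A -> w \notin B ->
    connect (induced e A) c w -> cut_vertex e A z.
  move=> BA wA wB cw; have [wz wK] := notinB w wB.
  have cz : c != z by apply: contraNneq zK => <-.
  have cA : c \in A by apply: (subsetP BA); rewrite in_setU1 cinK orbT.
  apply/andP; split; first exact: (subsetP BA).
  apply/existsP; exists c; rewrite in_setD1 cz cA /=.
  apply/existsP; exists w; rewrite in_setD1 wz wA cw /=.
  by apply: contra wK; apply: leaveK cinK; rewrite in_setD1 eqxx.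
have czT w : connect (induced e [set: T]) w z.
  have : z \in component e setT w.
    apply: (conn _ w); first exact: component_closed.
    by apply: component_refl; rewrite in_setT.
  by rewrite inE => /andP[].
have blockB : block e B.
  apply/maxsetP; split=> /=.
    apply/andP; split.
      apply/andP; split; first by apply/set0Pn; exists z.
      apply/forallP => u; apply/implyP => uB; apply/forallP => w; apply/implyP => wB.
      by apply: connect_trans (toz u uB) _; rewrite su; apply: toz.
    apply/existsPn => v; apply/negP => cv.
    have := cv; rewrite /cut_vertex => /andP[vB _].
    move: vB; rewrite in_setU1 => /predU1P[vz|vK]; last first.
      by have := nocut B v vK (subxx _) toz; rewrite cv.
    move: cv; rewrite vz => /andP[_ /existsP[u /andP[uB /existsP[w /andP[wB /andP[_ nuw]]]]]].
    have BK : B :\ z = K by rewrite setU1K.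
    rewrite BK in uB wB nuw.
    (* If [z] cut [B], a component of [K] would be a smaller set attached to [z] alone. *)
    apply: (small (component e K u) z).
    - rewrite properEneq component_sub andbT; apply: contraTneq wB => <-.
      by rewrite inE negb_and nuw orbT.
    - by apply/set0Pn; exists u; apply: component_refl.
    move=> a b aM _ eab; have aK := subsetP (component_sub _ _ _) _ aM.
    case/orP: (bK a b aK (in_setT _) eab) => [bK'|->]; last by rewrite orbT.
    by have := component_closed aM bK' eab; rewrite in_set0 orbF => ->.
  move=> A /andP[/andP[_ cA] nA] BA; apply/eqP; rewrite eqEsubset BA andbT.
  apply/subsetP => w wA; apply: contraT => wB; case/existsP: nA; exists z.
  have cA' : c \in A by apply: (subsetP BA); rewrite in_setU1 cinK orbT.
  apply: (cz_cut A w) => //.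
  by move/forallP/(_ c): cA; rewrite cA' => /forallP/(_ w); rewrite wA.
have endB : end_block e B.
  rewrite /end_block blockB /= -(cards1 z); apply: subset_leq_card; apply/subsetP => v.
  rewrite inE in_setU1 in_set1 => /andP[/orP[//|vK]].
  by rewrite (negbTE (nocut setT v vK (subsetT _) (fun w _ => czT w))).
(* The root required in the end block [B] can only be [z]; but the other root lies outside [B], so
   [z] is a cut vertex. *)
have := R2 B; rewrite endB => /existsP[t /andP[txy /andP[tB nct]]].
have tz : t = z.
  move: tB; rewrite in_setU1 => /predU1P[//|tK].
  by move: txy; rewrite in_set2 => /orP[]/eqP tE; move: xK yK; rewrite -tE tK.
have [o [oK oz]] : exists o, o \notin K /\ o != z.
  move: txy; rewrite tz in_set2 => /orP[]/eqP->; last by exists x.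
  by exists y; rewrite eq_sym.
case/negP: nct; rewrite tz; apply: (cz_cut setT o); rewrite ?subsetT ?in_setT //.
  by rewrite in_setU1 negb_or oz.
by apply: connect_trans (czT c) _; rewrite su.
Qed.

Lemma seq_choice (P : nat -> seq T -> Prop) k :
  (forall i, i < k -> exists p, P i p) ->
  exists H, size H = k /\ forall i, i < k -> P i (nth [::] H i).
Proof.
elim: k => [|k IHk] HP; first by exists [::].
have [H [sH hH]] := IHk (fun i ik => HP i (ltnW ik)).
have [p Pp] := HP k (ltnSn k).
exists (rcons H p); rewrite size_rcons sH; split=> // i.
rewrite ltnS leq_eqVlt nth_rcons sH => /predU1P[->|ik]; first by rewrite ltnn eqxx.
by rewrite ik; apply: hH.
Qed.

End Main.

Theorem theorem2 (k : nat) (T : finType) (e : rel T) (x y : T)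
    (k_gt0 : 0 < k) (e_sym : symmetric e) (e_irr : irreflexive e)
    (G2conn : two_connected_rooted e x y)
    (deg_ge : forall v : T, v != x -> v != y -> 2 * k <= degree e v) :
  exists H : seq (seq T),
    [/\ size H = k,
        forall p : seq T, p \in H -> path_from_to e x y p
      & length_condition H].
Proof.
have [a [a2 Ha]] : paths2 e [set: T] x y k.
  apply: (@all_paths2 _ #|T|.+1) => //.
  - by rewrite cardsT.
  - exact: two_connected_rootedP.
  move=> v _ vx vy; right; apply: leq_trans (deg_ge v vx vy) _.
  by apply: subset_leq_card; apply/subsetP => u; rewrite !inE.
have [|H [sH hH]] := @seq_choice T
  (fun i p => path_from_to e x y p /\ size p = a + 2 * i) k.
  move=> i /Ha[p [ep lp up _ zp]]; exists p; split=> //.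
  by rewrite /path_from_to ep lp eqxx.
exists H; split=> //.
  move=> p pH; rewrite -(nth_index [::] pH).
  by have [] := hH (index p H); rewrite // -sH index_mem.
split; first by have [_ ->] := hH 0 k_gt0; rewrite addn0.
move=> i; rewrite sH => ik; have [_ ->] := hH _ ik; have [_ ->] := hH _ (ltnW ik).
by rewrite mulnS; lia.
Qed.
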